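(* Let $\Omega\subset\mathbb{R}^n$ be an open, smooth, bounded and uniformly convex domain. Let $\lambda=\lambda(\Omega)>0$ and let $u\in C^2(\Omega)\cap C^1(\overline{\Omega})$ be a (nonzero, convex) solution of the Monge–Ampère eigenvalue problem $$\det(\nabla^2u)=\lambda|u|^n\ \text{ in }\Omega,\qquad u=0\ \text{ on }\partial\Omega.$$ Then $$\lambda\ge|B_1|\left(\frac{\inf_{\partial\Omega}|\nabla u|}{\|u\|_{L^n(\Omega)}}\right)^n.$$ In addition, $$\inf_{\partial\Omega}|\nabla u|\le\frac{C(n)}{|\Omega|^{2/n}}\,\|u\|_{L^n(\Omega)}$$ for some constant $C(n)$ depending only on the dimension $n$.
   Context: $B_1$ is the unit ball of $\mathbb{R}^n$; $|\cdot|$ applied to a set is Lebesgue measure. By a theorem of Lions, for such $\Omega$ there exist a unique constant $\lambda=\lambda(\Omega)>0$ and a unique (up to positive multiplicative constants) nonzero convex function $u\in C^{1,1}(\overline{\Omega})\cap C^\infty(\Omega)$ solving this eigenvalue problem; $\lambda(\Omega)$ denotes this constant. *)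

(* Defs.v *)
From HB Require Import structures.
From mathcomp Require Import all_boot all_order all_algebra.
From mathcomp Require Import all_classical all_reals all_analysis.
Set Implicit Arguments.
Unset Strict Implicit.
Unset Printing Implicit Defensive.
Import Order.TTheory GRing.Theory Num.Theory.
Import numFieldNormedType.Exports.
Local Open Scope classical_set_scope.
Local Open Scope ring_scope.

(* The topology and the library norm on 'rV[R]_n are those of the sup norm,
   so the Euclidean length is introduced separately. *)
Section euclidean.
Context {R : realType} {n : nat}.
Implicit Types u v : 'rV[R]_n.

Definition dotmul u v : R := \sum_(i < n) u 0 i * v 0 i.

Definition enorm u : R := Num.sqrt (dotmul u u).

Definition unit_ball : set 'rV[R]_n := [set x | enorm x < 1].

End euclidean.

(* The sigma-algebra on 'rV[R]_n is the product one, i.e., the Borel one. *)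
Section measurable_rV.
Context {R : realType} (n : nat).

Definition rV_coord (i : 'I_n) (x : 'rV[R]_n) : measurableTypeR R := x 0 i.

Let rV_set0 : g_sigma_preimage rV_coord set0.
Proof. exact: sigma_algebra0. Qed.

Let rV_setC A : g_sigma_preimage rV_coord A -> g_sigma_preimage rV_coord (~` A).
Proof. exact: sigma_algebraC. Qed.

Let rV_bigcup (F : (set 'rV[R]_n)^nat) :
  (forall i, g_sigma_preimage rV_coord (F i)) ->
  g_sigma_preimage rV_coord (\bigcup_i (F i)).
Proof. exact: sigma_algebra_bigcup. Qed.

HB.instance Definition _ := @isMeasurable.Build default_measure_display
  'rV[R]_n (g_sigma_preimage rV_coord) rV_set0 rV_setC rV_bigcup.

Lemma measurable_rV_coord (i : 'I_n) : measurable_fun setT (rV_coord i).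
Proof.
move=> _ Y mY; rewrite setTI; apply: sub_sigma_algebra => /=.
rewrite -bigcup_seq/=; exists i => /=; first by rewrite mem_index_enum.
by exists Y => //; rewrite setTI.
Qed.

Lemma measurable_fun_rV d (T : measurableType d) (f : T -> 'rV[R]_n) :
  (forall i, measurable_fun setT (rV_coord i \o f)) -> measurable_fun setT f.
Proof.
move=> mf _ A mA; rewrite setTI.
have : preimage_set_system setT f (g_sigma_preimage rV_coord) (f @^-1` A).
  by exists A => //; rewrite setTI.
rewrite -g_sigma_preimage_comp.
apply: smallest_sub; first exact: sigma_algebra_measurable.
rewrite -bigcup_seq; apply: bigcup_sub => i _ B [C mC <-]; exact: mf.
Qed.

End measurable_rV.

(* The sigma-finite instance of product_measure1 is shadowed in the library by
   the one for subprobabilities. *)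
Lemma product_sigma_finite d1 d2 (T1 : measurableType d1)
    (T2 : measurableType d2) (R : realType)
    (m1 : {sigma_finite_measure set T1 -> \bar R})
    (m2 : {sigma_finite_measure set T2 -> \bar R}) :
  sigma_finite setT (m1 \x m2)%E.
Proof. have /sigma_finiteP[F [TF ndF Foo]] := sigma_finiteT m1.
have /sigma_finiteP[G [TG ndG Goo]] := sigma_finiteT m2.
exists (fun n => F n `*` G n).
  rewrite -setXTT TF TG predeqE => -[x y]; split.
    move=> [/= [n _ Fnx] [k _ Gky]]; exists (maxn n k) => //; split.
    - by move: x Fnx; exact/subsetPset/ndF/leq_maxl.
    - by move: y Gky; exact/subsetPset/ndG/leq_maxr.
  by move=> [n _ []/= ? ?]; split; exists n.
move=> k; have [? ?] := Foo k; have [? ?] := Goo k.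
split; first exact: measurableX.
by rewrite product_measure1E// lte_mul_pinfty// ge0_fin_numE.
Qed.

(* Lebesgue measure on 'rV[R]_n, as the n-fold product of the Lebesgue measure
   on R, through the identification of R * 'rV[R]_n with 'rV[R]_n.+1. *)
Section lebesgue_rV.
Context {R : realType}.

Definition cons_rV n (p : measurableTypeR R * 'rV[R]_n) : 'rV[R]_n.+1 :=
  row_mx (const_mx p.1 : 'rV_1) p.2.

Definition uncons_rV n (x : 'rV[R]_n.+1) : measurableTypeR R * 'rV[R]_n :=
  (x 0 ord0, rsubmx (x : 'rV_(1 + n))).

Lemma cons_rVK n : cancel (@cons_rV n) (@uncons_rV n).
Proof.
case=> a x; rewrite /uncons_rV /cons_rV row_mxKr; congr pair.
rewrite /= (_ : ord0 = lshift n (ord0 : 'I_1)); last exact/val_inj.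
by rewrite (row_mxEl (const_mx a : 'rV[R]_1) x) mxE.
Qed.

Lemma measurable_cons_rV n : measurable_fun setT (@cons_rV n).
Proof.
apply: measurable_fun_rV => i.
case: (@splitP 1 n i) => j ij.
- have -> : i = lshift n j by exact/val_inj.
  rewrite (_ : _ \o _ = fst); first exact: measurable_fst.
  apply/funext => -[a x] /=.
  by rewrite /rV_coord (row_mxEl (const_mx a : 'rV[R]_1) x) mxE.
- have -> : i = rshift 1 j by exact/val_inj.
  rewrite (_ : _ \o _ = rV_coord j \o snd); last first.
    apply/funext => -[a x] /=.
    by rewrite /rV_coord (row_mxEr (const_mx a : 'rV[R]_1) x).
  exact: measurableT_comp (measurable_rV_coord j) measurable_snd.
Qed.

Lemma measurable_uncons_rV n : measurable_fun setT (@uncons_rV n).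
Proof.
apply: measurable_fun_pair => /=; first exact: measurable_rV_coord.
apply: measurable_fun_rV => i.
rewrite (_ : _ \o _ = rV_coord (rshift 1 i)); first exact: measurable_rV_coord.
by apply/funext => x; rewrite /rV_coord /= mxE.
Qed.

Section step.
Variables (n : nat) (mu : {sigma_finite_measure set 'rV[R]_n -> \bar R}).

Definition lebesgue_rV_step : set 'rV[R]_n.+1 -> \bar R :=
  pushforward (@lebesgue_measure R \x mu)%E (@cons_rV n).

HB.instance Definition _ := Measure.copy lebesgue_rV_step
  (measure_function_pushforward__canonical__measure_function_Measure
     (@lebesgue_measure R \x mu)%E (@measurable_cons_rV n)).

Let lebesgue_rV_step_sigma_finite : sigma_finite setT lebesgue_rV_step.
Proof.
have [F FT Foo] := product_sigma_finite (@lebesgue_measure R) mu.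
exists (fun k => @uncons_rV n @^-1` F k).
  by rewrite -preimage_bigcup -FT preimage_setT.
move=> k; have [mF muF] := Foo k; split.
  by rewrite -[X in measurable X]setTI; exact: measurable_uncons_rV.
rewrite /lebesgue_rV_step /pushforward -comp_preimage.
by rewrite (_ : _ \o _ = id)//; apply/funext => p; exact: cons_rVK.
Qed.

HB.instance Definition _ :=
  Measure_isSigmaFinite.Build _ _ _ lebesgue_rV_step
    lebesgue_rV_step_sigma_finite.

End step.

Fixpoint lebesgue_rV (n : nat) :
    {sigma_finite_measure set 'rV[R]_n -> \bar R} :=
  match n with
  | 0 => @dirac _ 'rV[R]_0 0 R
  | n'.+1 => lebesgue_rV_step (lebesgue_rV n')
  end.

End lebesgue_rV.

Section calculus.
Context {R : realType} {n : nat}.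
Implicit Types (O : set 'rV[R]_n) (f : 'rV[R]_n -> R) (x : 'rV[R]_n).

Definition partial (i : 'I_n) f : 'rV[R]_n -> R :=
  'D_('e_i : 'rV[R]_n) f.

Definition gradient f x : 'rV[R]_n := \row_i partial i f x.

Definition hessian f x : 'M[R]_n := \matrix_(i, j) partial j (partial i f) x.

(* f is of class C^k on the open set O *)
Fixpoint Ck (k : nat) O f : Prop :=
  if k is k'.+1 then
    (forall x, O x -> differentiable f x) /\ forall i, Ck k' O (partial i f)
  else forall x, O x -> {for x, continuous f}.

Definition Csmooth O f : Prop := forall k, Ck k O f.

(* f is C^1 up to the boundary: f is continuous on the closure of O, and its
   gradient in O extends continuously to the closure. *)
Definition C1_closure O f : Prop :=
  [/\ Ck 1 O f, {within closure O, continuous f} &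
    exists2 G : 'rV[R]_n -> 'rV[R]_n,
      {within closure O, continuous G} & forall x, O x -> G x = gradient f x].

Definition C11_closure O f : Prop :=
  C1_closure O f /\ [lipschitz gradient f x | x in O].

(* For f in C1_closure O, the value at x of the continuous extension of the
   gradient of f to the closure of O; meant for x on the boundary, where the
   derivatives of f itself may not exist. *)
Definition gradient_ext O f x : 'rV[R]_n :=
  lim (gradient f y @[y --> within O (nbhs x)]).

Definition boundary O : set 'rV[R]_n := closure O `\` O°.

End calculus.

Section domains.
Context {R : realType} {n : nat}.
Implicit Types (O : set 'rV[R]_n) (rho : 'rV[R]_n -> R) (x : 'rV[R]_n).

(* Near x, the set O is the sublevel set {rho < 0} of a smooth function rho
   whose gradient does not vanish at x. *)
Definition defining_function O x rho : Prop :=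
  exists U : set 'rV[R]_n,
    [/\ open U, U x, Csmooth U rho, gradient rho x != 0 &
      forall y, U y -> (O y <-> rho y < 0)].

Definition smooth_boundary O : Prop :=
  forall x, boundary O x -> exists rho, defining_function O x rho.

(* The second fundamental form of the boundary {rho = 0}, with respect to the
   inner normal, is xi |-> (D^2 rho xi . xi) / |grad rho| on tangent vectors;
   uniform convexity means that the principal curvatures are bounded below by a
   positive constant. *)
Definition uniformly_convex O : Prop :=
  @convex_set R 'rV[R]_n O /\
  exists2 kappa : R, 0 < kappa &
    forall x rho, boundary O x -> defining_function O x rho ->
    forall xi : 'rV[R]_n, dotmul (gradient rho x) xi = 0 ->
      kappa * enorm (gradient rho x) * enorm xi ^+ 2
        <= dotmul (xi *m hessian rho x) xi.

Definition smooth_uniformly_convex_domain O : Prop :=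
  [/\ open O, O !=set0, bounded_set O, smooth_boundary O & uniformly_convex O].

End domains.

Section monge_ampere.
Context {R : realType} {n : nat}.
Implicit Types (O : set 'rV[R]_n) (lambda : R) (u : 'rV[R]_n -> R).

Definition MA_eigenproblem O lambda u : Prop :=
  (forall x, O x -> \det (hessian u x) = lambda * `|u x| ^+ n) /\
  (forall x, boundary O x -> u x = 0).

Definition nonzero_convex O u : Prop :=
  (exists2 x, O x & u x != 0) /\ @convex_function R 'rV[R]_n O u.

(* lambda is the Monge-Ampere eigenvalue lambda(O) given by the theorem of
   Lions, which also provides its uniqueness. *)
Definition MA_eigenvalue O lambda : Prop :=
  0 < lambda /\
  exists v, [/\ C11_closure O v, Csmooth O v, nonzero_convex O v &
    MA_eigenproblem O lambda v].

Definition volume O : R := fine (lebesgue_rV n O).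

Definition Lpnorm (p : R) O u : R :=
  fine ('N[lebesgue_rV n]_(p%:E) [EFin \o (u \_ O)])%E.

Definition inf_boundary_gradient O u : R :=
  inf [set enorm (gradient_ext O u x) | x in boundary O].

End monge_ampere.

(* Main.v *)
Require Import Defs.
From HB Require Import structures.
From mathcomp Require Import all_boot all_order all_algebra.
From mathcomp Require Import all_classical all_reals all_analysis.
From mathcomp Require Import perm measurable_realfun.
From mathcomp Require Import ring lra.
Import Order.TTheory GRing.Theory Num.Theory.
Import numFieldNormedType.Exports.
Local Open Scope classical_set_scope.
Local Open Scope ring_scope.

Set Implicit Arguments.
Unset Strict Implicit.
Unset Printing Implicit Defensive.

(* Write N for the L^n norm of u and m for the infimum of |grad u| over the boundary.

   For the first bound, grad u maps Omega onto a set containing the ball of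
   radius m: for |p| < m the minimum of u - p.x over the closure of Omega is
   attained inside, since on the boundary grad u points outwards with length at
   least m. As det D^2 u = lambda |u|^n is the Jacobian of grad u, the area
   inequality |F(Omega)| <= \int_Omega |det DF| gives |B_1| m^n <= lambda N^n.

   For the second bound it remains to see that lambda |Omega|^2 is bounded by a
   dimensional constant. Omega contains an ellipsoid of comparable volume,
   inscribed in an almost largest simplex with a given vertex, and in the
   coordinates y of the ellipsoid a multiple of the bump (1 - |y|^2)^2 touches
   -u from below at an interior point, where D^2 u is therefore bounded. *)

(** * Affine images of Lebesgue measure *)

(** In the area inequality countable subadditivity lets the images of small cubes overlap. Since u <
    0 in Omega, det D^2 u > 0 there, so only maps with invertible derivative have to be treated:
    they send a small cube into almost the parallelepiped given by the derivative.

    The product lambda |Omega|^2 is natural because in coordinates x = z + yB the constant lambda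
    becomes lambda (det B)^2; an ellipsoid of comparable volume thus reduces the estimate to the
    unit ball, whatever the shape of Omega. Fixing one vertex turns the choice of the simplex into
    the maximisation of a determinant. Omega being open, the supremum need not be attained, and half
    of it is enough.

    The bump is squared to keep the contact point away from the unit sphere. Contact with a multiple
    of 1 - |y|^2 would bound D^2 u as well, but with no lower bound on 1 - |y|^2, by which one
    finally divides. The square is strictly subharmonic near the sphere whereas -u is concave, so
    contact there is impossible. *)

Section affine1.
Context {R : realType}.
Implicit Types (a b : R) (B : set (measurableTypeR R)).

Definition affine1 a b : measurableTypeR R -> measurableTypeR R :=
  fun s : R => (a * s + b : R).

Lemma measurable_affine1 a b : measurable_fun setT (affine1 a b).
Proof.
apply: continuous_measurable_fun => s; apply: cvgD; last exact: cvg_cst.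
by apply: cvgM; [exact: cvg_cst|exact: cvg_id].
Qed.

(** Lebesgue measure is determined by its values on half-open intervals, where it is compared with
    [|a|] times the pushforward. For a < 0 the preimage of such an interval is open at the other
    end, which does not affect its length. *)
Lemma lebesgue_measure_affine1 a b B : a != 0 -> measurable B ->
  (lebesgue_measure (affine1 a b @^-1` B) = (`|a|^-1)%:E * lebesgue_measure B)%E.
Proof.
move=> a0 mB; have na0 : 0 < `|a| by rewrite normr_gt0.
have nna : 0 <= `|a| by exact: ltW.
pose pm := measure_function_pushforward__canonical__measure_function_Measure
  (@lebesgue_measure R) (measurable_affine1 a b).
pose m := mscale (NngNum nna) pm.
suff -> : lebesgue_measure B = m B.
  by rewrite /m /mscale /= muleA -EFinM mulVf ?gt_eqF// mul1e.
apply: lebesgue_measure_unique => // _ [[p q] _ <-].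
change (lebesgue_measure `]p, q] =
  `|a|%:E * lebesgue_measure (affine1 a b @^-1` `]p, q]))%E.
have [a_gt0|a_lt0|a_eq0] := ltgtP 0 a; last by rewrite -a_eq0 eqxx in a0.
- have -> : affine1 a b @^-1` `]p, q] = `](p - b) / a, (q - b) / a]%classic.
    apply/seteqP; split => s /=; rewrite !in_itv/= /affine1 -ltrBlDr -lerBrDr;
      by rewrite ltr_pdivrMr// ler_pdivlMr// [s * a]mulrC.
  rewrite !lebesgue_measure_itv/= !lte_fin ltr_pM2r ?invr_gt0// ltrD2r.
  case: ifP => // _; last by rewrite mule0.
  by rewrite -!EFinD -EFinM gtr0_norm//; congr EFin; field.
- have -> : affine1 a b @^-1` `]p, q] = `[(q - b) / a, (p - b) / a[%classic.
    apply/seteqP; split => s /=; rewrite !in_itv/= /affine1 -ltrBlDr -lerBrDr;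
      by rewrite ler_ndivrMr// ltr_ndivlMr// [s * a]mulrC andbC.
  rewrite !lebesgue_measure_itv/= !lte_fin ltr_nM2r ?invr_lt0// ltrD2r.
  case: ifP => // _; last by rewrite mule0.
  by rewrite -!EFinD -EFinM ltr0_norm//; congr EFin; field.
Qed.

End affine1.

Section affine.
Context {R : realType}.
Local Notation leb := (@lebesgue_measure R).

Lemma measurable_cons_rV_preimage n (A : set 'rV[R]_n.+1) : measurable A ->
  measurable (@cons_rV R n @^-1` A).
Proof. by move=> mA; rewrite -[X in measurable X]setTI; exact: measurable_cons_rV. Qed.

Lemma lebesgue_rV_cons n (A : set 'rV[R]_n.+1) : measurable A ->
  lebesgue_rV n.+1 A =
  (\int[leb]_a lebesgue_rV n [set y | A (cons_rV (a, y))])%E.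
Proof.
move=> mA; rewrite /= /lebesgue_rV_step /pushforward /product_measure1.
apply: eq_integral => a _ /=; congr (lebesgue_rV n _).
by apply/seteqP; split => y; rewrite /xsection /= inE.
Qed.

Lemma lebesgue_rV_cons_swap n (A : set 'rV[R]_n.+1) : measurable A ->
  lebesgue_rV n.+1 A =
  (\int[lebesgue_rV n]_y leb [set a | A (cons_rV (a, y))])%E.
Proof.
move=> mA; rewrite /= /lebesgue_rV_step /pushforward.
have mA' := measurable_cons_rV_preimage mA.
have -> : (leb \x lebesgue_rV n)%E (@cons_rV R n @^-1` A) =
          (leb \x^ lebesgue_rV n)%E (@cons_rV R n @^-1` A).
  by apply: product_measure_unique => //= B C mB mC; rewrite product_measure2E.
apply: eq_integral => y _ /=; congr (leb _).
by apply/seteqP; split => a; rewrite /ysection /= inE.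
Qed.

Lemma uncons_rVK n : cancel (@uncons_rV R n) (@cons_rV R n).
Proof.
move=> y; apply/rowP => i; case: (@splitP 1 n i) => j ij.
- have -> : i = lshift n j by exact/val_inj.
  rewrite (row_mxEl (const_mx _ : 'rV[R]_1)) mxE; congr (y _ _).
  by apply/val_inj; rewrite /= (ord1 j).
- have -> : i = rshift 1 j by exact/val_inj.
  by rewrite (row_mxEr (const_mx _ : 'rV[R]_1)) mxE.
Qed.

Lemma measurable_cons_rV_section n (B : set 'rV[R]_n.+1) (t : R) : measurable B ->
  measurable [set z | B (cons_rV (t, z))].
Proof.
move=> mB.
have := @measurable_xsection _ _ _ _ (@cons_rV R n @^-1` B) (t : measurableTypeR R)
  (measurable_cons_rV_preimage mB).
by congr (measurable _); apply/seteqP; split => z; rewrite /xsection /= inE.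
Qed.

Lemma measurable_cons_rV_ysection n (B : set 'rV[R]_n.+1) (y : 'rV[R]_n) : measurable B ->
  measurable [set s : measurableTypeR R | B (cons_rV (s, y))].
Proof.
move=> mB.
have := @measurable_ysection _ _ _ _ (@cons_rV R n @^-1` B) y
  (measurable_cons_rV_preimage mB).
by congr (measurable _); apply/seteqP; split => z; rewrite /ysection /= inE.
Qed.

Lemma measurable_rV_affine n (M : 'M[R]_n) (b : 'rV[R]_n) :
  measurable_fun setT (fun y : 'rV[R]_n => y *m M + b).
Proof.
apply: measurable_fun_rV => i.
rewrite (_ : _ \o _ = fun y => \sum_j rV_coord j y * M j i + b 0 i); last first.
  by apply/funext => y /=; rewrite /rV_coord !mxE.
apply: measurable_funD; last exact: measurable_cst.
apply: measurable_sum => j; apply: measurable_funM; last exact: measurable_cst.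
exact: measurable_rV_coord.
Qed.

Lemma measurable_rV_affine_preimage n (M : 'M[R]_n) (b : 'rV[R]_n) B :
  measurable B -> measurable [set y : 'rV[R]_n | B (y *m M + b)].
Proof.
by move=> mB; rewrite -[X in measurable X]setTI; exact: measurable_rV_affine.
Qed.

Let scales n (M : 'M[R]_n) (b : 'rV[R]_n) := forall B, measurable B ->
  lebesgue_rV n [set y | B (y *m M + b)] = ((`|\det M|^-1)%:E * lebesgue_rV n B)%E.

Let scalesM n (M N : 'M[R]_n) b c :
  scales M c -> scales N b -> scales (M *m N) (c *m N + b).
Proof.
move=> sM sN B mB; have := sM _ (measurable_rV_affine_preimage N b mB).
rewrite sN// det_mulmx normrM invfM EFinM muleA => <-; congr (lebesgue_rV n _).
by apply/seteqP; split => y /=; rewrite mulmxDl mulmxA addrA.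
Qed.

Lemma cons_rV_ublock n (a s : R) (r y : 'rV[R]_n) (M : 'M[R]_n) (b : 'rV[R]_n.+1) :
  (cons_rV (s, y) : 'rV_(1 + n)) *m block_mx a%:M r 0 M + b =
  cons_rV (affine1 a (uncons_rV b).1 s, y *m M + (s *: r + (uncons_rV b).2)).
Proof.
rewrite -{1}(uncons_rVK b) /cons_rV mul_row_block add_row_mx mulmx0 addr0.
congr row_mx.
- by apply/rowP => j; rewrite mul_mx_scalar !mxE /affine1.
- rewrite addrA [y *m M + _]addrC; congr (_ + _ + _).
  by apply/rowP => j; rewrite !mxE big_ord1 !mxE.
Qed.

Lemma cons_rV_shear n (s : R) (y : 'rV[R]_n) (c : 'cV[R]_n) :
  (cons_rV (s, y) : 'rV_(1 + n)) *m block_mx 1%:M 0 c 1%:M =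
  cons_rV (affine1 1 ((y *m c) 0 0) s, y).
Proof.
rewrite /cons_rV mul_row_block mulmx0 add0r !mulmx1; congr row_mx.
by apply/rowP => j; rewrite !mxE (ord1 j) /affine1 mul1r.
Qed.

(** At a fixed first coordinate s the map acts on the rest by M with a translation depending on s,
    hence the quantifier over c. What remains is a one-dimensional scaling by a. *)
Let scales_ublock n (a : R) (r : 'rV[R]_n) (M : 'M[R]_n) b : a != 0 ->
  (forall c, scales M c) -> @scales n.+1 (block_mx a%:M r 0 M) b.
Proof.
move=> a0 sM B mB; have mB' := measurable_rV_affine_preimage _ b mB.
rewrite lebesgue_rV_cons//.
pose G (t : measurableTypeR R) := lebesgue_rV n [set z | B (cons_rV (t, z))].
have mG : measurable_fun setT G.
  rewrite (_ : G = lebesgue_rV n \o xsection (@cons_rV R n @^-1` B)).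
    exact: measurable_fun_xsection (measurable_cons_rV_preimage mB).
  apply/funext => t; rewrite /G /=; congr (lebesgue_rV n _).
  by apply/seteqP; split => z; rewrite /xsection /= inE.
have G0 t : (0 <= G t)%E by exact: measure_ge0.
transitivity (\int[leb]_s
    ((`|\det M|^-1)%:E * G (affine1 a (uncons_rV b).1 s)))%E.
  apply: eq_integral => s _.
  rewrite -(sM (s *: r + (uncons_rV b).2)); last first.
    exact: measurable_cons_rV_section.
  congr (lebesgue_rV n _); apply/seteqP; split => y /=; rewrite cons_rV_ublock//.
rewrite ge0_integralZl//; last first.
  exact: (measurableT_comp mG (measurable_affine1 _ _)).
have -> : \det (block_mx a%:M r 0 M : 'M[R]_n.+1) = a * \det M.
  by rewrite (@det_ublock _ 1 n) det_scalar1.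
rewrite normrM invfM [_^-1 * _^-1]mulrC EFinM -muleA.
congr (_ * _)%E.
rewrite lebesgue_rV_cons// -/G.
pose pm := measure_function_pushforward__canonical__measure_function_Measure
  leb (measurable_affine1 a (uncons_rV b).1).
have ia : 0 <= `|a|^-1 by rewrite invr_ge0.
transitivity (\int[pm]_t G t)%E.
  rewrite (ge0_integral_pushforward (measurable_affine1 a (uncons_rV b).1) leb)//.
rewrite (eq_measure_integral (mscale (NngNum ia) leb)); last first.
  move=> A mA _; exact: lebesgue_measure_affine1.
by rewrite ge0_integral_mscale.
Qed.

(** At fixed y the shear translates s by [y *m c]; this is why the sections are taken in the other
    order here. *)
Let scales_shear n (c : 'cV[R]_n) : @scales n.+1 (block_mx 1%:M 0 c 1%:M) 0.
Proof.
move=> B mB; have mB' := measurable_rV_affine_preimage (block_mx 1%:M 0 c 1%:M) 0 mB.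
rewrite !lebesgue_rV_cons_swap//.
have -> : \det (block_mx 1%:M 0 c 1%:M : 'M[R]_n.+1) = 1.
  by rewrite (@det_lblock _ 1 n) !det1 mulr1.
rewrite normr1 invr1 mul1e.
apply: eq_integral => y _.
have mBy := measurable_cons_rV_ysection y mB.
have /= := lebesgue_measure_affine1 ((y *m c) 0 0) (oner_neq0 R) mBy.
rewrite normr1 invr1 mul1e => <-; congr (leb _).
by apply/seteqP; split => s /=; rewrite addr0 cons_rV_shear.
Qed.

Let scales0M n (M N : 'M[R]_n) :
  scales M 0 -> (forall b, scales N b) -> forall b, scales (M *m N) b.
Proof.
by move=> sM sN b; have := scalesM sM (sN b); rewrite mul0mx add0r.
Qed.

(** Block Gaussian elimination by induction on n: a nonzero corner entry splits the matrix into a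
    shear and a block triangular factor whose lower block [D] is the Schur complement. A zero corner
    is first made nonzero by a row operation. *)
Lemma lebesgue_rV_affine n (M : 'M[R]_n) b B : M \in unitmx -> measurable B ->
  lebesgue_rV n [set y | B (y *m M + b)] = ((`|\det M|^-1)%:E * lebesgue_rV n B)%E.
Proof.
suff: M \in unitmx -> forall b, scales M b by move=> + Mu; apply.
elim: n M {b B} => [M _ b B mB|n IH M].
  rewrite det_mx00 normr1 invr1 mul1e; congr (lebesgue_rV 0 _).
  by apply/seteqP; split => y /=; rewrite (thinmx0 (y *m M + b)) -(thinmx0 y).
pose blk (M : 'M[R]_n.+1) : 'M[R]_(1 + n) := M.
have pivot (N : 'M[R]_n.+1) : N \in unitmx -> N 0 0 != 0 ->
    forall b, scales N b.
  move=> Nu a0; set a := N 0 0 in a0.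
  pose r := ursubmx (blk N); pose c := dlsubmx (blk N).
  have ulN : ulsubmx (blk N) = a%:M.
    apply/matrixP => i j; rewrite !mxE !ord1 eqxx mulr1n.
    by congr (N _ _); exact/val_inj.
  pose D := drsubmx (blk N) - a^-1 *: c *m r.
  have NE : N = block_mx 1%:M 0 (a^-1 *: c) 1%:M *m block_mx a%:M r 0 D.
    rewrite -[LHS]/(blk N) -[blk N]submxK mulmx_block !mul1mx !mul0mx !addr0.
    rewrite ulN mul_mx_scalar scalerA mulfV// scale1r.
    by rewrite /D addrC subrK.
  have Du : D \in unitmx.
    move: Nu; rewrite NE !unitmxE det_mulmx (@det_lblock _ 1 n) (@det_ublock _ 1 n) !det1 !mul1r.
    by rewrite det_scalar1 !unitfE mulf_eq0 negb_or => /andP[].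
  rewrite NE; apply: scales0M (scales_shear _) _ => b.
  by apply: scales_ublock a0 _ => c'; exact: IH.
move=> Mu; have [a0|a0] := eqVneq (M 0 0) 0; last exact: pivot.
have [i Mi0] : exists i : 'I_n, dlsubmx (blk M) i 0 != 0.
  apply/existsP; apply: contraLR Mu => /existsPn Mi0.
  rewrite unitmxE unitfE negbK; apply/eqP.
  rewrite (expand_det_col _ (0 : 'I_n.+1)) big1// => k _.
  have -> : M k 0 = 0; last by rewrite mul0r.
  case: (@splitP 1 n k) => j kj.
    by rewrite -[RHS]a0; congr (M _ _); apply/val_inj; rewrite /= kj (ord1 j).
  have /negPn/eqP <- := Mi0 j; rewrite !mxE.
  by congr (M _ _); exact/val_inj.
(* [E t] adds t times the row of index i + 1 to the first row, and [E (-1)] undoes [E 1]. *)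
pose E (t : R) : 'M[R]_n.+1 :=
  @block_mx R 1 n 1 n 1%:M (t *: delta_mx 0 i) 0 1%:M.
have Eu t : E t \in unitmx by rewrite unitmxE (@det_ublock _ 1 n) !det1 mulr1 unitr1.
have E1 : (E 1 *m M) 0 0 != 0.
  suff -> : (E 1 *m M) 0 0 = dlsubmx (blk M) i 0 by [].
  have -> : E 1 *m M = E 1 *m block_mx (ulsubmx (blk M)) (ursubmx (blk M))
      (dlsubmx (blk M)) (drsubmx (blk M)) by rewrite submxK.
  rewrite /E (@mulmx_block _ 1 n 1 n 1 n) !mul1mx.
  have -> : (0 : 'I_n.+1) = lshift n (0 : 'I_1) by exact/val_inj.
  rewrite (@block_mxEul _ 1 n 1 n) scale1r mxE.
  have -> : ulsubmx (blk M) 0 0 = 0.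
    by rewrite !mxE -[RHS]a0; congr (M _ _); exact/val_inj.
  by rewrite add0r -rowE mxE.
have -> : M = E (-1) *m (E 1 *m M).
  rewrite mulmxA /E (@mulmx_block _ 1 n 1 n 1 n) !mul1mx !mulmx1 !mul0mx mulmx0 addr0 add0r.
  rewrite scale1r scaleN1r addrN add0r.
  by rewrite -(@scalar_mx_block _ 1 n) mul1mx.
apply: scales0M.
  by apply: scales_ublock (oner_neq0 R) _ => c; exact/IH/unitmx1.
by apply: pivot => //; rewrite unitmx_mul Eu.
Qed.

End affine.

(** * Cubes and parallelepipeds *)

Section cubes.
Context {R : realType} {n : nat}.
Implicit Types (x y v a : 'rV[R]_n) (e h : R).

Lemma coord_le_norm v i : `|v 0 i| <= `|v|.
Proof.
rewrite [leRHS]/Num.Def.normr/= mx_normrE.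
exact: (le_bigmax _ (fun ij : 'I_1 * 'I_n => `|v ij.1 ij.2|) (0, i)).
Qed.

Lemma rV_norm_le v e : 0 <= e -> (forall i, `|v 0 i| <= e) -> `|v| <= e.
Proof.
move=> e0 ve; rewrite [leLHS]/Num.Def.normr/= mx_normrE; apply/bigmax_leP; split => //.
by case=> i j _ /=; rewrite (ord1 i).
Qed.

Lemma rV_norm_lt v e : 0 < e -> (forall i, `|v 0 i| < e) -> `|v| < e.
Proof.
move=> e0 ve; rewrite [ltLHS]/Num.Def.normr/= mx_normrE; apply/bigmax_ltP; split => //.
by case=> i j _ /=; rewrite (ord1 i).
Qed.

Lemma mulmx_norm_le m (M : 'M[R]_(n, m)) :
  exists2 c : R, 0 < c & forall v : 'rV[R]_n, `|v *m M| <= c * `|v|.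
Proof.
exists (\sum_i \sum_j `|M i j| + 1) => [|v].
  by rewrite ltr_wpDl// sumr_ge0// => i _; rewrite sumr_ge0.
have v0 : 0 <= `|v| by [].
rewrite [leLHS]/Num.Def.normr/= mx_normrE; apply/bigmax_leP; split.
  by rewrite mulr_ge0// addr_ge0// sumr_ge0// => i _; rewrite sumr_ge0.
case=> i j _ /=; rewrite (ord1 i) !mxE (le_trans (ler_norm_sum _ _ _))//.
rewrite mulrDl mul1r ler_wpDr// mulr_suml ler_sum// => k _.
rewrite normrM mulrC ler_pM// ?coord_le_norm//.
by rewrite (bigD1 j)//= lerDl sumr_ge0.
Qed.

(** Half-open, so that the cubes of a dyadic grid partition the space. *)
Definition cube a h : set 'rV[R]_n := [set x | forall i, a 0 i <= x 0 i < a 0 i + h].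

Lemma cube_norm_lt a h x y : 0 < h -> cube a h x -> cube a h y -> `|y - x| < h.
Proof.
move=> h0 ax ay; apply: rV_norm_lt => // i; rewrite !mxE.
by move/andP: (ax i) => [? ?]; move/andP: (ay i) => [? ?]; rewrite ltr_norml; lra.
Qed.

Lemma measurable_cube a h : measurable (cube a h).
Proof.
rewrite (_ : cube a h = \bigcap_(i : 'I_n)
    (@rV_coord R n i @^-1` `[a 0 i, a 0 i + h[)); last first.
  apply/seteqP; split => x /= xa i; first by move=> _; rewrite /= in_itv/=; exact: xa.
  by have := xa i I; rewrite /= in_itv.
apply: fin_bigcap_measurable => // i _.
by rewrite -[X in measurable X]setTI; apply: measurable_rV_coord => //; exact: measurable_itv.
Qed.

End cubes.

Lemma lebesgue_rV_unit_cube {R : realType} n : lebesgue_rV n (@cube R n 0 1) = 1%E.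
Proof.
elim: n => [|n IH].
  by rewrite /= diracE mem_set// => -[].
rewrite lebesgue_rV_cons; last exact: measurable_cube.
rewrite (eq_integral (fun a : measurableTypeR R =>
    (\1_(`[0, 1[%classic : set (measurableTypeR R)) a)%:E)); last first.
  move=> a _; rewrite indicE.
  have cE : [set y | cube 0 1 (cons_rV (a, y))] =
      [set y | 0 <= a < 1 /\ @cube R n 0 1 y].
    apply/seteqP; split => y /=.
      move=> ay; split => [|i].
        have := ay (lshift n (0 : 'I_1)).
        by rewrite /cons_rV (row_mxEl (const_mx a : 'rV[R]_1)) !mxE add0r.
      have := ay (rshift 1 i).
      by rewrite /cons_rV (row_mxEr (const_mx a : 'rV[R]_1)) !mxE add0r.
    move=> [a01 y01] i; case: (@splitP 1 n i) => j ij.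
      have -> : i = lshift n j by exact/val_inj.
      by rewrite /cons_rV (row_mxEl (const_mx a : 'rV[R]_1)) !mxE add0r.
    have -> : i = rshift 1 j by exact/val_inj.
    have := y01 j.
    by rewrite /cons_rV (row_mxEr (const_mx a : 'rV[R]_1)) !mxE add0r.
  rewrite cE; have [a01|a01] := boolP (a \in `[0, 1[%classic).
    have {}a01 : 0 <= a < 1 by move: a01; rewrite inE/= in_itv.
    rewrite -[RHS]IH; congr (lebesgue_rV n _).
    by apply/seteqP; split => y /=; [case|].
  rewrite (_ : mkset _ = set0) ?measure0//; apply/seteqP; split => y //= [a01' _].
  by move: a01; rewrite notin_setE /= in_itv/= a01'.
rewrite integral_indic// setIT.
transitivity (@lebesgue_measure R `[0, 1[); first by [].
by rewrite lebesgue_measure_itv/= lte_fin ltr01 sube0.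
Qed.

Section cube_measure.
Context {R : realType} {n : nat}.
Implicit Types (a : 'rV[R]_n) (h : R).

Lemma lebesgue_rV_cube a h : 0 < h -> lebesgue_rV n (cube a h) = (h ^+ n)%:E.
Proof.
move=> h0; have h_neq0 : h != 0 by rewrite gt_eqF.
have hu : (h^-1)%:M \in @unitmx R n by rewrite unitmxE det_scalar unitrX// unitfE invr_neq0.
have := lebesgue_rV_affine (- (h^-1 *: a)) hu (measurable_cube 0 1).
rewrite lebesgue_rV_unit_cube mule1 det_scalar normrX ger0_norm ?invr_ge0 ?ltW//.
rewrite exprVn invrK => <-; congr (lebesgue_rV n _).
apply/seteqP; split => y /= ya i; have := ya i;
  rewrite mul_mx_scalar !mxE -mulrBr add0r;
  by rewrite [h^-1 * _]mulrC ler_pdivlMr// ltr_pdivrMr// mul0r mul1r subr_ge0 ltrBlDl.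
Qed.

Lemma lebesgue_rV_parallelepiped (M : 'M[R]_n) b a h : M \in unitmx -> 0 < h ->
  lebesgue_rV n [set y | cube a h (y *m M + b)] = (`|\det M|^-1 * h ^+ n)%:E.
Proof.
move=> Mu h0; rewrite lebesgue_rV_affine//; last exact: measurable_cube.
by rewrite lebesgue_rV_cube.
Qed.

End cube_measure.

(** * Dyadic cubes *)

Section dyadic.
Context {R : realType} {n : nat}.
Implicit Types (x y : 'rV[R]_n) (O : set 'rV[R]_n).

Definition dyad_index j x : 'rV[int]_n := \row_i Num.floor (2 ^+ j * x 0 i).

Definition dyad j x : set 'rV[R]_n := [set y | dyad_index j y = dyad_index j x].

Lemma dyadE j x :
  dyad j x = cube (\row_i ((dyad_index j x 0 i)%:~R / 2 ^+ j)) (2 ^+ j)^-1.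
Proof.
have j0 : 0 < 2 ^+ j :> R by rewrite exprn_gt0.
have cE y : cube (\row_i ((dyad_index j x 0 i)%:~R / 2 ^+ j)) (2 ^+ j)^-1 y <->
    forall i, (dyad_index j x 0 i)%:~R <= 2 ^+ j * y 0 i < (dyad_index j x 0 i)%:~R + 1.
  have kE (k : R) : k / 2 ^+ j + (2 ^+ j)^-1 = (k + 1) / 2 ^+ j.
    by rewrite mulrDl mul1r.
  have aE i : (\row_i ((dyad_index j x 0 i)%:~R / 2 ^+ j) : 'rV[R]_n) 0 i =
      (dyad_index j x 0 i)%:~R / 2 ^+ j by rewrite mxE.
  by split=> xy i; have := xy i;
    rewrite aE kE ler_pdivrMr// ltr_pdivlMr// ![y 0 i * _]mulrC.
apply/seteqP; split => y.
  move=> yx; apply/cE => i; rewrite -yx mxE floor_le/=.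
  by rewrite -[X in _ + X]/(1%:~R) -intrD floorD1_gt.
move/cE => yx; apply/rowP => i; have := yx i; rewrite [RHS]mxE; move/andP => [ge lt].
rewrite mxE; apply/floor_def; rewrite mxE in ge lt.
by rewrite ge intrD.
Qed.

Lemma dyad_refl j x : dyad j x x. Proof. by []. Qed.

Lemma measurable_dyad j x : measurable (dyad j x).
Proof. by rewrite dyadE; exact: measurable_cube. Qed.

(** Nestedness of the grids: the floor of 2 t determines that of t, because an integer k satisfies k
    <= t exactly when 2 k <= 2 t. *)
Lemma dyad_indexS j x y :
  dyad_index j.+1 x = dyad_index j.+1 y -> dyad_index j x = dyad_index j y.
Proof.
move=> xy; apply/rowP => i; rewrite [RHS]mxE mxE; apply/floor_def.
have := congr1 (fun v : 'rV_n => v 0 i) xy; rewrite !mxE !exprS -!mulrA.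
move: (2 ^+ j * x 0 i) (2 ^+ j * y 0 i) => s t st.
apply/andP; split.
  have : (2 * Num.floor t)%:~R <= 2 * t.
    by rewrite intrM ler_pM2l// floor_le.
  by rewrite -floor_ge_int -st floor_ge_int intrM ler_pM2l.
have : 2 * t < (2 * (Num.floor t + 1))%:~R.
  by rewrite intrM ltr_pM2l// floorD1_gt.
by rewrite -floor_lt_int -st floor_lt_int intrM ltr_pM2l.
Qed.

Lemma dyad_index_le j j' x y : (j' <= j)%N ->
  dyad_index j x = dyad_index j y -> dyad_index j' x = dyad_index j' y.
Proof.
move=> /subnK <-; elim: (j - j')%N => // k IH /dyad_indexS; exact: IH.
Qed.

(* The family C enumerates the coarsest good dyadic cubes. *)
Lemma dyadic_cover O (good : set 'rV[R]_n -> Prop) :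
  (forall x, O x -> exists j, good (dyad j x)) ->
  (forall Q, good Q -> Q `<=` O) ->
  exists C : (set 'rV[R]_n)^nat,
    [/\ trivIset setT C, \bigcup_m C m = O &
      forall m, C m = set0 \/ exists j x, C m = dyad j x /\ good (C m)].
Proof.
move=> Ogood goodO.
(* [D (j, k)] is the cube of level j and index k if it is good and no coarser dyadic cube around it
   is; otherwise it is empty. Each point of O selects its first good level, so these sets are
   disjoint and cover O. *)
pose D (p : nat * 'rV[int]_n) := [set x | [/\ dyad_index p.1 x = p.2,
  good (dyad p.1 x) & forall j, (j < p.1)%N -> ~ good (dyad j x)]].
have DE p x : D p x -> D p = dyad p.1 x.
  move=> [xp gx mx]; apply/seteqP; split => y.
    by move=> [yp _ _]; rewrite /dyad /= yp.
  move=> yx; have dE j : (j <= p.1)%N -> dyad j y = dyad j x.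
    by move=> jp; rewrite /dyad (dyad_index_le jp yx).
  split; first by rewrite -xp.
    by rewrite dE.
  by move=> j jp; rewrite dE ?(ltnW jp)//; exact: mx.
pose C m := if pickle_inv m is Some p then D p else set0.
exists C; split.
- apply/trivIsetP => m m' _ _; apply: contraNeq => /set0P[x []].
  rewrite /C; case Ep : (pickle_inv m) => [p|//]; case Ep' : (pickle_inv m') => [p'|//].
  move=> [xp gx mx] [xp' gx' mx'].
  suff pp' : p = p'.
    have := @pickle_invK (nat * 'rV[int]_n)%type m; rewrite Ep /= => <-.
    have := @pickle_invK (nat * 'rV[int]_n)%type m'; rewrite Ep' /= => <-.
    by rewrite pp'.
  have pp1 : p.1 = p'.1.
    case: (ltngtP p.1 p'.1) => // h; first by case: (mx' _ h).
    by case: (mx _ h).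
  by rewrite [p]surjective_pairing [p']surjective_pairing -xp -xp' pp1.
- apply/seteqP; split => x.
    move=> [m _]; rewrite /C; case: (pickle_inv m) => // p [_ /goodO + _].
    by apply; exact: dyad_refl.
  move=> Ox; have ex : exists j, `[< good (dyad j x) >].
    by have [j gj] := Ogood _ Ox; exists j; apply/asboolP.
  case: (ex_minnP ex) => j /asboolP gj jmin.
  exists (pickle (j, dyad_index j x)) => //; rewrite /C pickleK_inv.
  split => //= j' jj' /asboolP/jmin; by rewrite leqNgt jj'.
- move=> m; rewrite /C; case: (pickle_inv m) => [p|]; last by left.
  have [->|/set0P[x Dx]] := eqVneq (D p) set0; first by left.
  right; exists p.1, x; rewrite -(DE _ _ Dx); split => //.
  by rewrite (DE _ _ Dx); case: Dx.
Qed.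

Lemma dyad_small x (e : R) : 0 < e -> exists j, dyad j x `<=` [set y | `|y - x| < e].
Proof.
move=> e0.
have [j je] : exists j : nat, (2 ^+ j)^-1 < e :> R.
  have [j je] := @ltr_add_invr R 0 e e0.
  exists j; rewrite add0r in je; apply: le_lt_trans je.
  by rewrite lef_pV2 ?posrE ?exprn_gt0// -natrX ler_nat ltn_expl.
exists j => y; rewrite dyadE => xy.
apply: lt_trans je; apply: cube_norm_lt _ _ xy; first by rewrite invr_gt0 exprn_gt0.
by rewrite -dyadE; exact: dyad_refl.
Qed.

(** The sigma-algebra is generated by the coordinates, so open sets have to be recovered in it: each
    is a countable union of dyadic cubes. *)
Lemma open_rV_measurable O : open O -> measurable O.
Proof.
move=> oO.
have Ogood x : O x -> exists j, dyad j x `<=` O.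
  move=> Ox; have /nbhs_ballP[e /= e0 eO] : nbhs x O by exact: open_nbhs_nbhs.
  have [j je] := dyad_small x e0; exists j => y /je yx; apply: eO.
  by rewrite -ball_normE /ball_/= distrC.
have [C [_ <- Cd]] := dyadic_cover Ogood (fun Q => id).
apply: bigcupT_measurable => m; have [->|[j [x [-> _]]]] := Cd m => //.
exact: measurable_dyad.
Qed.

Lemma continuous_rV_measurable O (f : 'rV[R]_n -> R) : open O ->
  (forall x, O x -> {for x, continuous f}) -> measurable_fun O f.
Proof.
move=> oO cf mO; apply: (measurability _ (RGenOInfty.measurableE R)) => //.
move=> /= _ [_ [a ->] <-]; apply: open_rV_measurable.
rewrite openE => x [Ox xa]; rewrite /interior.
apply: filterI; first exact: open_nbhs_nbhs.
apply: (cf _ Ox); apply: open_nbhs_nbhs; split => //; exact: interval_open.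
Qed.

End dyadic.

(** * The area inequality *)

Section area.
Context {R : realType} {n : nat}.
Implicit Types (x y : 'rV[R]_n) (O : set 'rV[R]_n).
Local Notation mu := (@lebesgue_rV R n).

(** Frechet differentiability of F at x. Vectors being rows, J is the transpose of the usual
    Jacobian matrix. *)
Definition jacobian_at (F : 'rV[R]_n -> 'rV[R]_n) (J : 'M[R]_n) x :=
  forall e : R, 0 < e -> exists2 d : R, 0 < d &
    forall y, `|y - x| < d -> `|F y - F x - (y - x) *m J| <= e * `|y - x|.

Let expand_small (D c e : R) : 0 <= D -> 0 < e ->
  exists2 t : R, 0 < t & D * (1 + 2 * (c * t)) ^+ n <= D + e.
Proof.
move=> D0 e0; pose f (t : R) : R := D * (1 + 2 * (c * t)) ^+ n.
have cf : {for 0, continuous f}.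
  apply: cvgM; first exact: cvg_cst.
  apply: (@continuous_comp _ _ _ (fun t : R => 1 + 2 * (c * t)) (fun t : R => t ^+ n));
    last exact: exprn_continuous.
  apply: cvgD; first exact: cvg_cst.
  apply: cvgM; first exact: cvg_cst.
  by apply: cvgM; [exact: cvg_cst|exact: cvg_id].
have /nbhs_ballP[d /= d0 dP] : \forall t \near (0 : R), f t < D + e.
  have := cf; move/cvgr_lt; apply.
  by rewrite /f !mulr0 addr0 expr1n mulr1 ltrDl.
exists (d / 2); first by rewrite divr_gt0.
apply: ltW; apply: dP; rewrite /ball /= sub0r normrN gtr0_norm ?divr_gt0//.
by lra.
Qed.

(** Followed by the affine map [z |-> z *m invmx J + b], F differs from the identity by at most c t
    h on the cube, so the image of the cube lies over a cube of side h (1 + 2 c t). The point x is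
    anywhere in the cube, not its centre, so that dyadic cubes qualify. *)
Lemma cube_image_le F J x (e : R) : J \in unitmx -> jacobian_at F J x -> 0 < e ->
  exists2 d : R, 0 < d & forall a h, 0 < h < d -> cube a h x ->
    exists P, [/\ measurable P, F @` cube a h `<=` P &
      (mu P <= ((`|\det J| + e) * h ^+ n)%:E)%E].
Proof.
move=> Ju FJ e0.
have [c c0 cP] := mulmx_norm_le (invmx J).
have [t t0 tP] := expand_small c (normr_ge0 (\det J)) e0.
have [d d0 dP] := FJ _ t0.
exists d => // a h /andP[h0 hd] ax.
pose s := c * t; have s0 : 0 < s by rewrite mulr_gt0.
have h'0 : 0 < h * (1 + 2 * s) by rewrite mulr_gt0// addr_gt0// mulr_gt0.
pose b := x - F x *m invmx J.
exists [set z | cube (a - const_mx (s * h)) (h * (1 + 2 * s)) (z *m invmx J + b)]; split.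
- apply: measurable_rV_affine_preimage; exact: measurable_cube.
- move=> _ [y ay <-] /=.
  have yx : `|y - x| < h := cube_norm_lt h0 ax ay.
  pose r := (F y - F x - (y - x) *m J) *m invmx J.
  have rh : `|r| <= s * h.
    rewrite (le_trans (cP _))// /s -mulrA ler_pM2l//.
    by rewrite (le_trans (dP _ _)) ?(lt_trans yx)// ler_pM2l// ltW.
  have -> : F y *m invmx J + b = y + r.
    rewrite /r /b !mulmxBl !mulmxK//; apply/rowP => i; rewrite !mxE; ring.
  move=> i; have := le_trans (coord_le_norm r i) rh.
  rewrite ler_norml !mxE => /andP[ri1 ri2]; have /andP[ai1 ai2] := ay i.
  by apply/andP; split; nra.
- rewrite lebesgue_rV_parallelepiped ?unitmx_inv// lee_fin.
  rewrite det_inv normrV ?unitfE -?unitfE// invrK exprMn mulrCA [leRHS]mulrC.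
  by rewrite ler_pM2l ?exprn_gt0.
Qed.

(* Each point lies in a small dyadic cube whose image under F is covered by a
   parallelepiped of measure at most the integral of g + e over the cube. *)
Lemma measure_image_le O F J (g : 'rV[R]_n -> R) A :
  open O -> (mu O < +oo)%E ->
  (forall x, O x -> J x \in unitmx /\ jacobian_at F (J x) x) ->
  (forall x, O x -> {for x, continuous g}) ->
  (forall x, O x -> `|\det (J x)| <= g x) ->
  measurable A -> A `<=` F @` O ->
  (mu A <= \int[mu]_(x in O) (g x)%:E)%E.
Proof.
move=> oO Ooo FJ cg Jg mA AF.
have mO := open_rV_measurable oO.
have g0 x : O x -> 0 <= g x by move=> /Jg; exact: le_trans.
have mg : measurable_fun O (EFin \o g).
  by apply/measurable_EFinP; exact: continuous_rV_measurable.
have eps e : 0 < e -> (mu A <= \int[mu]_(x in O) (g x + e)%:E)%E.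
  move=> e0; have mge : measurable_fun O (fun x => (g x + e)%:E).
    by apply/measurable_EFinP; apply: measurable_funD => //; exact/measurable_EFinP.
  pose good Q := Q `<=` O /\ exists P, [/\ measurable P, F @` Q `<=` P &
    (mu P <= \int[mu]_(x in Q) (g x + e)%:E)%E].
  have [|Q []//|C [tC UC dC]] := @dyadic_cover R n O good.
    move=> x Ox; have [Ju Fx] := FJ _ Ox.
    (* One half of e pays for the distortion of F on the cube, the other for the oscillation of
       g. *)
    have e2 : 0 < e / 2 by rewrite divr_gt0.
    have [d d0 dP] := cube_image_le Ju Fx e2.
    have : \forall y \near x, O y /\ g x - e / 2 < g y.
      apply: filterI; first exact: open_nbhs_nbhs.
      by have := cg _ Ox; move/cvgr_gt; apply; rewrite ltrBlDr ltrDl.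
    move=> /nbhs_ballP[r /= r0 rP].
    have [j jr] : exists j, (2 ^+ j)^-1 < Num.min d r :> R.
      have [j je] := @ltr_add_invr R 0 (Num.min d r) (ltac:(by rewrite lt_min d0)).
      exists j; rewrite add0r in je; apply: le_lt_trans je.
      by rewrite lef_pV2 ?posrE ?exprn_gt0// -natrX ler_nat ltn_expl.
    move: jr; rewrite lt_min => /andP[jd jr].
    have h0 : 0 < (2 ^+ j)^-1 :> R by rewrite invr_gt0 exprn_gt0.
    exists j; have xj : dyad j x x by exact: dyad_refl.
    have Qr y : dyad j x y -> O y /\ g x - e / 2 < g y.
      move=> yj; apply: rP; rewrite -ball_normE /ball_/= distrC.
      by apply: lt_trans jr; rewrite !dyadE in xj yj; exact: cube_norm_lt xj yj.
    split; first by move=> y /Qr[].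
    have [|P [mP FP muP]] := dP _ _ _ (eq_ind _ (fun Q => Q x) xj _ (dyadE j x)).
      by rewrite h0.
    exists P; split => //; first by rewrite dyadE.
    apply: (le_trans muP); rewrite EFinM.
    rewrite -(lebesgue_rV_cube (\row_i ((dyad_index j x 0 i)%:~R / 2 ^+ j)) h0) -dyadE.
    rewrite -(integral_cst mu (measurable_dyad j x)).
    apply: ge0_le_integral => //; first exact: measurable_dyad.
    - by move=> y _; rewrite /cst lee_fin addr_ge0// ltW.
    - by apply: measurable_funS mge => // y /Qr[].
    - by move=> y /Qr[_ gy]; rewrite lee_fin; have := Jg _ Ox; lra.
  have mC m : measurable (C m).
    by have [->//|[j [x [-> _]]]] := dC m; exact: measurable_dyad.
  have CP m : exists P, [/\ measurable P, F @` C m `<=` P &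
      (mu P <= \int[mu]_(x in C m) (g x + e)%:E)%E].
    have [->|[j [x [-> [_ //]]]]] := dC m.
    by exists set0; rewrite image_set0 integral_set0 measure0; split.
  pose P m := projT1 (cid (CP m)).
  have PP m : [/\ measurable (P m), F @` C m `<=` P m &
      (mu (P m) <= \int[mu]_(x in C m) (g x + e)%:E)%E].
    by rewrite /P; case: cid.
  have AP : A `<=` \bigcup_m P m.
    move=> z /AF[x]; rewrite -UC => -[m _ Cx] <-; exists m => //.
    by have [_ + _] := PP m; apply; exists x.
  apply: (@le_trans _ _ (\sum_(m <oo) mu (P m))%E).
    by apply: measure_sigma_subadditive => // m; have [] := PP m.
  rewrite -[in leRHS]UC ge0_integral_bigcup//=.
  - by apply: lee_nneseries => m *; [exact: measure_ge0|have [] := PP m].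
  - by rewrite UC.
  - by move=> x; rewrite UC => Ox; rewrite lee_fin addr_ge0 ?g0// ltW.
apply/lee_addgt0Pr => e e0.
have muO0 : 0 <= fine (mu O) by exact/fine_ge0/measure_ge0.
(* The summand 1 keeps the denominator positive when O is null. *)
pose e' := e / (fine (mu O) + 1).
have e'0 : 0 < e' by rewrite divr_gt0// ltr_wpDl.
apply: (le_trans (eps _ e'0)).
under eq_integral do rewrite EFinD.
rewrite ge0_integralD//; last by move=> x _; rewrite lee_fin ltW.
apply: leeD2l; rewrite -/(cst e'%:E) integral_cst//.
rewrite -[X in (_ * X)%E]fineK ?ge0_fin_numE//.
rewrite -EFinM lee_fin /e' mulrAC ler_pdivrMr ?ltr_wpDl//.
by rewrite ler_pM2l// lerDl.
Qed.

End area.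

(** * Derivatives along lines *)

Section dotmul.
Context {R : realType} {n : nat}.
Implicit Types u v w : 'rV[R]_n.

Lemma dotmulC u v : dotmul u v = dotmul v u.
Proof. by apply: eq_bigr => i _; rewrite mulrC. Qed.

Lemma dotmulDl u v w : dotmul (u + v) w = dotmul u w + dotmul v w.
Proof. by rewrite -big_split; apply: eq_bigr => i _; rewrite mxE mulrDl. Qed.

Lemma dotmulZl (a : R) u v : dotmul (a *: u) v = a * dotmul u v.
Proof. by rewrite mulr_sumr; apply: eq_bigr => i _; rewrite mxE mulrA. Qed.

Lemma dotmulDr u v w : dotmul w (u + v) = dotmul w u + dotmul w v.
Proof. by rewrite dotmulC dotmulDl !(dotmulC w). Qed.

Lemma dotmulZr (a : R) u v : dotmul u (a *: v) = a * dotmul u v.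
Proof. by rewrite dotmulC dotmulZl dotmulC. Qed.

Lemma dotmulNl u v : dotmul (- u) v = - dotmul u v.
Proof. by rewrite -scaleN1r dotmulZl mulN1r. Qed.

Lemma dotmulNr u v : dotmul u (- v) = - dotmul u v.
Proof. by rewrite dotmulC dotmulNl dotmulC. Qed.

Lemma dotmulBl u v w : dotmul (u - v) w = dotmul u w - dotmul v w.
Proof. by rewrite dotmulDl dotmulNl. Qed.

Lemma dotmulBr u v w : dotmul w (u - v) = dotmul w u - dotmul w v.
Proof. by rewrite dotmulDr dotmulNr. Qed.

Lemma dotmulvv_ge0 u : 0 <= dotmul u u.
Proof. by apply: sumr_ge0 => i _; rewrite -expr2 sqr_ge0. Qed.

Lemma dotmulvv_gt0 u : u != 0 -> 0 < dotmul u u.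
Proof.
move=> u0; rewrite lt_neqAle dotmulvv_ge0 andbT eq_sym; apply: contra u0.
rewrite psumr_eq0 => [/allP u0|i _]; last by rewrite -expr2 sqr_ge0.
apply/eqP/rowP => i; rewrite mxE.
by have := u0 i (mem_index_enum i); rewrite /= mulf_eq0 orbb => /eqP.
Qed.

Lemma dotmul_delta u i : dotmul u ('e_i) = u 0 i.
Proof.
rewrite /dotmul (bigD1 i)//= big1 => [|j ji]; first by rewrite mxE !eqxx mulr1 addr0.
by rewrite mxE eqxx (negPf ji) mulr0.
Qed.

Lemma dotmul_quadratic (M : 'M[R]_n) u v :
  dotmul (u *m M) v = \sum_i \sum_j u 0 i * M i j * v 0 j.
Proof.
rewrite exchange_big; apply: eq_bigr => j _ /=.
by rewrite mxE mulr_suml.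
Qed.

Lemma sqr_enorm u : enorm u ^+ 2 = dotmul u u.
Proof. by rewrite sqr_sqrtr// dotmulvv_ge0. Qed.

Lemma enorm_ge0 u : 0 <= enorm u.
Proof. exact: sqrtr_ge0. Qed.

Lemma enorm_lt u (m : R) : 0 < m -> (enorm u < m) = (dotmul u u < m ^+ 2).
Proof.
by move=> m0; rewrite -sqr_enorm ltr_pXn2r// ?nnegrE ?enorm_ge0// ltW.
Qed.

Lemma enormZ (a : R) u : enorm (a *: u) = `|a| * enorm u.
Proof.
by rewrite /enorm dotmulZl dotmulZr mulrA -expr2 sqrtrM ?sqr_ge0// sqrtr_sqr.
Qed.

Lemma sqr_coord_le u i : u 0 i ^+ 2 <= dotmul u u.
Proof.
rewrite /dotmul (bigD1 i)//= -expr2 lerDl sumr_ge0// => j _.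
by rewrite -expr2 sqr_ge0.
Qed.

Lemma coord_le1 u i : dotmul u u <= 1 -> `|u 0 i| <= 1.
Proof.
move=> u1; rewrite -(@ler_pXn2r _ 2)// ?nnegrE// expr1n real_normK ?num_real//.
by rewrite (le_trans (sqr_coord_le _ i)).
Qed.

Lemma row_sum_scale u : u = \sum_i u 0 i *: ('e_i : 'rV[R]_n).
Proof. exact: row_sum_delta. Qed.

End dotmul.

Section calculus.
Context {R : realType} {n : nat}.
Implicit Types (f : 'rV[R]_n -> R) (x v : 'rV[R]_n) (O : set 'rV[R]_n).

Lemma derive_gradient f x v : differentiable f x -> 'D_v f x = dotmul (gradient f x) v.
Proof.
move=> df; rewrite deriveE// {1}(row_sum_scale v) linear_sum; apply: eq_bigr => i _.
by rewrite linearZ /= -deriveE// mxE mulrC.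
Qed.

Lemma is_derive_line f x v (s : R) : differentiable f (x + s *: v) ->
  is_derive s 1 (fun t : R => f (x + t *: v)) (dotmul (gradient f (x + s *: v)) v).
Proof.
move=> df; have dv := diff_derivable (v := v) df.
have E : (fun h : R => h^-1 *: (((fun t : R => f (x + t *: v)) \o shift s) (h *: 1) -
    f (x + s *: v))) = (fun h => h^-1 *: ((f \o shift (x + s *: v)) (h *: v) - f (x + s *: v))).
  apply/funext => h /=; congr (_ *: (f _ - _)).
  by rewrite [h *: 1]mulr1 scalerDl addrCA.
apply: DeriveDef; first by rewrite /derivable E.
by rewrite -derive_gradient// /derive E.
Qed.

Lemma differentiable_expansion f x : differentiable f x ->
  forall e : R, 0 < e -> exists2 d : R, 0 < d & forall y, `|y - x| < d ->
    `|f y - f x - dotmul (gradient f x) (y - x)| <= e * `|y - x|.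
Proof.
move=> df e e0; have /eqaddoP/(_ e e0) := diff_locally df.
move=> /nbhs_ballP[d /= d0 dP]; exists d => // y yx.
have /dP /= : ball (0 : 'rV[R]_n) d (y - x).
  by rewrite -ball_normE /ball_/= sub0r normrN.
have -> : (f \o shift x - (cst (f x) + 'd f x)) (y - x) =
    f y - f x - dotmul (gradient f x) (y - x).
  rewrite !fctE /= -derive_gradient// deriveE//.
  by rewrite subrK opprD addrA.
exact.
Qed.

Lemma gradient_jacobian f x : (forall i, differentiable (partial i f) x) ->
  jacobian_at (gradient f) (hessian f x)^T x.
Proof.
move=> df e e0.
have dP i := differentiable_expansion (df i) e0.
pose d i := projT1 (cid2 (dP i)).
have d0 i : 0 < d i by rewrite /d; case: cid2.
have dE i y : `|y - x| < d i -> `|partial i f y - partial i f x -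
    dotmul (gradient (partial i f) x) (y - x)| <= e * `|y - x|.
  by rewrite /d; case: cid2 => ? ? /=; apply.
exists (\big[Num.min/1]_i d i); first exact: lt_bigmin.
move=> y /bigmin_gtP[_ yx]; apply: rV_norm_le; first by rewrite mulr_ge0// ltW.
move=> i; have := dE i y (yx i isT); congr (`|_| <= _).
rewrite !mxE; congr (_ - _); rewrite dotmulC; apply: eq_bigr => j _.
by rewrite !mxE.
Qed.

(** The derivative of [g'] is taken at 0 only. If c < 0, then [g' 0 = 0] makes [g'] negative just to
    the right of 0, and by the mean value theorem g drops below its minimum. *)
Lemma second_derivative_ge0 (g g' : R -> R) (c d : R) : 0 < d ->
  (forall s : R, `|s| < d -> is_derive s 1 g (g' s)) -> is_derive (0 : R) 1 g' c ->
  (forall s, `|s| < d -> g 0 <= g s) -> 0 <= c.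
Proof.
move=> d0 dg dg' gmin; rewrite leNgt; apply/negP => c0.
have in_d s : s \in `](- d), d[ -> `|s| < d by rewrite in_itv/= ltr_norml.
have g'0 : g' 0 = 0.
  have g0 : is_derive (0 : R) 1 g 0.
    apply: (@derive1_at_min _ g (- d) d).
    - by rewrite ge0_cp// ltW.
    - by move=> t /in_d /dg[].
    - by rewrite in_itv/= oppr_lt0 d0.
    - by move=> t /in_d/gmin.
  have := dg 0; rewrite normr0 => /(_ d0) dg0.
  by case: dg0 => _ <-; case: g0.
have [cv cE] := dg'.
have : \forall h \near (0 : R)^', h^-1 *: ((g' \o shift 0) (h *: 1) - g' 0) < 0.
  have : h^-1 *: ((g' \o shift 0) (h *: 1) - g' 0) @[h --> 0^'] --> c.
    by rewrite -cE; exact: cv.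
  by move/cvgr_lt; apply.
move=> /nbhs_ballP[r /= r0 rP].
pose s := Num.min d r / 2.
have m0 : 0 < Num.min d r by rewrite lt_min d0.
have s0 : 0 < s by rewrite divr_gt0.
have sm : s < Num.min d r by rewrite /s; lra.
have [sd sr] : s < d /\ s < r by move: sm; rewrite lt_min => /andP.
have dgs t : 0 <= t <= s -> is_derive t 1 g (g' t).
  by move=> /andP[t0 ts]; apply: dg; rewrite ger0_norm// (le_lt_trans ts).
have [||t] := @MVT R g g' 0 s s0.
- move=> t; rewrite in_itv/= => /andP[t0 ts]; apply: dgs.
  by rewrite !ltW.
- apply: derivable_within_continuous => t; rewrite in_itv/= => /dgs[] //.
rewrite in_itv/= subr0 => /andP[t0 ts] gE.
have : g' t < 0.
  have := rP t; rewrite /ball /= sub0r normrN gtr0_norm// (lt_trans ts)//=.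
  move=> /(_ isT); rewrite gt_eqF// => /(_ isT).
  rewrite addr0 g'0 subr0 [t *: 1]mulr1.
  by rewrite /GRing.scale/= pmulr_rlt0 ?invr_gt0.
move=> g't; have := gmin s; rewrite gtr0_norm// => /(_ sd).
by rewrite -subr_ge0 gE pmulr_lge0// leNgt g't.
Qed.

Lemma is_derive_gradient_line f x v :
  (forall i, differentiable (partial i f) x) ->
  is_derive (0 : R) 1 (fun t : R => dotmul (gradient f (x + t *: v)) v)
    (dotmul (v *m hessian f x) v).
Proof.
move=> df.
have -> : (fun t : R => dotmul (gradient f (x + t *: v)) v) =
    \sum_(i < n) (v 0 i *: (fun t : R => partial i f (x + t *: v))).
  apply/funext => t; rewrite fct_sumE; apply: eq_bigr => i _.
  by rewrite mxE mulrC.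
have -> : dotmul (v *m hessian f x) v =
    \sum_(i < n) v 0 i *: dotmul (gradient (partial i f) (x + 0 *: v)) v.
  rewrite scale0r addr0 dotmul_quadratic; apply: eq_bigr => i _.
  rewrite /GRing.scale/= mulr_sumr; apply: eq_bigr => j _.
  by rewrite !mxE mulrA.
apply: is_derive_sum => i; apply: is_deriveZ; apply: is_derive_line.
by rewrite scale0r addr0.
Qed.

End calculus.

(** * Second derivatives of convex functions *)

Section second_order.
Context {R : realType} {n : nat}.
Implicit Types (f : 'rV[R]_n -> R) (x v : 'rV[R]_n) (O : set 'rV[R]_n).

Lemma norm_delta_le i : `|'e_i : 'rV[R]_n| <= 1.
Proof.
apply: rV_norm_le => // j; rewrite mxE eqxx /=.
by case: (j == i); rewrite ?normr1 ?normr0.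
Qed.

(** The double difference is [phi h - phi 0]. The mean value theorem expresses it by the partial
    derivative along e_i at two points near x, which differentiability at x expands to first
    order. *)
Lemma mixed_difference f x i j (r : R) : 0 < r ->
  (forall y, `|y - x| < r -> differentiable f y) ->
  differentiable (partial i f) x ->
  forall e : R, 0 < e -> exists2 d : R, 0 < d & forall h : R, 0 < h < d ->
    `|f (x + h *: 'e_j + h *: 'e_i) - f (x + h *: 'e_i) - (f (x + h *: 'e_j) - f x)
      - h ^+ 2 * hessian f x i j| <= e * h ^+ 2.
Proof.
move=> r0 df dfi e e0.
(* The expansion is used at distances at most h and 2 h from x, so the errors add up to 3 e h /
   4. *)
have e4 : 0 < e / 4 by rewrite divr_gt0.
have [d d0 dP] := differentiable_expansion dfi e4.
have m0 : 0 < Num.min d r by rewrite lt_min d0.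
exists (Num.min d r / 2); first by rewrite divr_gt0.
move=> h /andP[h0 hm].
have {hm} [hd hr] : 2 * h < d /\ 2 * h < r.
  by apply/andP; rewrite -lt_min; lra.
have n1 t : 0 <= t <= h -> `|(x + t *: 'e_i) - x| <= h.
  move=> /andP[t0 th]; rewrite addrC addKr normrZ ger0_norm//.
  by rewrite (le_trans _ th)// ler_piMr// norm_delta_le.
have n2 t : 0 <= t <= h -> `|(x + h *: 'e_j + t *: 'e_i) - x| <= 2 * h.
  move=> /andP[t0 th]; rewrite -(addrA x) [x + _ - x]addrC addKr (le_trans (ler_normD _ _))//.
  have nd (k : R) l : 0 <= k -> `|k *: ('e_l : 'rV[R]_n)| <= k.
    by move=> k0; rewrite normrZ ger0_norm// ler_piMr// norm_delta_le.
  by rewrite mulrDl mul1r lerD ?nd ?(le_trans (nd _ _ t0))// ltW.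
pose phi (t : R) := f (x + h *: 'e_j + t *: 'e_i) - f (x + t *: 'e_i).
pose dphi (t : R) := partial i f (x + h *: 'e_j + t *: 'e_i) - partial i f (x + t *: 'e_i).
have dphiE t : 0 <= t <= h -> is_derive t 1 phi (dphi t).
  move=> th; rewrite /dphi.
  have pE y : partial i f y = dotmul (gradient f y) 'e_i by rewrite dotmul_delta mxE.
  rewrite !pE.
  apply: is_deriveB; apply: is_derive_line; apply: df.
    by rewrite (le_lt_trans (n2 _ th)).
  by rewrite (le_lt_trans (n1 _ th))//; lra.
have [||t] := @MVT R phi dphi 0 h h0.
- by move=> t; rewrite in_itv/= => /andP[t0 th]; apply: dphiE; rewrite !ltW.
- by apply: derivable_within_continuous => t; rewrite in_itv/= => /dphiE[].
rewrite in_itv/= subr0 => /andP[t0 th].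
rewrite /phi !scale0r !addr0 => ->.
have tE : 0 <= t <= h by rewrite !ltW.
have := dP _ (le_lt_trans (n2 _ tE) hd).
have := dP _ (le_lt_trans (n1 _ tE) (ltac:(lra) : h < d)).
rewrite [x + t *: _ - x]addrC addKr dotmulZr dotmul_delta.
have -> : x + h *: 'e_j + t *: 'e_i - x = h *: 'e_j + t *: ('e_i : 'rV[R]_n).
  by rewrite -(addrA x) [x + _ - x]addrC addKr.
rewrite dotmulDr !dotmulZr !dotmul_delta mxE [gradient (partial i f) x 0 j]mxE.
rewrite [hessian f x i j]mxE /dphi.
have := n1 _ tE; rewrite [x + t *: _ - x]addrC addKr.
have := n2 _ tE.
have -> : x + h *: 'e_j + t *: 'e_i - x = h *: 'e_j + t *: ('e_i : 'rV[R]_n).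
  by rewrite -(addrA x) [x + _ - x]addrC addKr.
move: (`|_ + _|) (`|t *: _|) => N2 N1 N2h N1h.
move: (partial i f _) (partial i f _) (partial i f x) (partial i (partial i f) x)
  (partial j (partial i f) x) => p2 p1 p0 Hi Hj H1 H2.
have {}H1 : `|p1 - p0 - t * Hi| <= e / 4 * h by rewrite (le_trans H1)// ler_pM2l.
have {}H2 : `|p2 - p0 - (h * Hj + t * Hi)| <= e / 4 * (2 * h).
  by rewrite (le_trans H2)// ler_pM2l.
have -> : (p2 - p1) * h - h ^+ 2 * Hj = h * (p2 - p1 - h * Hj) by ring.
rewrite normrM gtr0_norm// expr2 mulrCA ler_pM2l//.
move: H1 H2; rewrite !ler_norml => /andP[? ?] /andP[? ?].
by have ? := mulr_gt0 e0 h0; apply/andP; split; lra.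
Qed.

(** The double difference is symmetric in i and j, and divided by h^2 it tends to both mixed
    derivatives. *)
Lemma hessian_sym O f x : open O -> O x -> Ck 2 O f ->
  (hessian f x)^T = hessian f x.
Proof.
move=> oO Ox [df /= d2f].
have /nbhs_ballP[r /= r0 rP] : nbhs x O by exact: open_nbhs_nbhs.
have dfr y : `|y - x| < r -> differentiable f y.
  by move=> yx; apply/df/rP; rewrite -ball_normE /ball_/= distrC.
apply/matrixP => i j; rewrite mxE; apply/eqP; rewrite -subr_eq0 -normr_le0.
apply/ler_addgt0Pr => e e0; rewrite add0r.
have e2 : 0 < e / 2 by rewrite divr_gt0.
have [d d0 dP] := mixed_difference j r0 dfr (proj1 (d2f i) _ Ox) e2.
have [d' d'0 d'P] := mixed_difference i r0 dfr (proj1 (d2f j) _ Ox) e2.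
pose h := Num.min d d' / 2.
have m0 : 0 < Num.min d d' by rewrite lt_min d0.
have h0 : 0 < h by rewrite divr_gt0.
have [hd hd'] : h < d /\ h < d' by apply/andP; rewrite -lt_min /h; lra.
have := dP h; rewrite h0 hd => /(_ isT).
have := d'P h; rewrite h0 hd' => /(_ isT).
rewrite (addrAC x (h *: 'e_i)).
move: (f _) (f _) (f _) (f _) (hessian f x j i) (hessian f x i j) => a b c k A B H1 H2.
have h2 : 0 < h ^+ 2 by rewrite exprn_gt0.
rewrite -(ler_pM2r h2) -[X in _ * X](gtr0_norm h2) -normrM ler_norml.
move: H1 H2; rewrite !ler_norml => /andP[? ?] /andP[? ?].
by apply/andP; split; lra.
Qed.

Lemma convex_set_comb O x y (t : R) : @convex_set R 'rV[R]_n O -> O x -> O y ->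
  0 <= t <= 1 -> O (t *: x + (1 - t) *: y).
Proof.
move=> cO Ox Oy /andP[t0 t1].
by have := cO x y (Itv01 t0 t1); rewrite !inE; apply.
Qed.

Lemma convex_function_comb O f x y (t : R) : @convex_function R 'rV[R]_n O f ->
  O x -> O y -> 0 <= t <= 1 ->
  f (t *: x + (1 - t) *: y) <= t * f x + (1 - t) * f y.
Proof.
move=> cf Ox Oy /andP[t0 t1].
by have := cf (Itv01 t0 t1) x y; rewrite !inE; apply.
Qed.

(** By midpoint convexity f(x + s v) + f(x - s v) is minimal at s = 0, and its second derivative
    there is twice the quadratic form. The symmetrisation spares the subtraction of a tangent. *)
Lemma convex_hessian_ge0 O f x v : open O -> O x -> Ck 2 O f ->
  @convex_function R 'rV[R]_n O f -> 0 <= dotmul (v *m hessian f x) v.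
Proof.
move=> oO Ox [df /= d2f] cf.
have /nbhs_ballP[r /= r0 rP] : nbhs x O by exact: open_nbhs_nbhs.
pose d := r / (`|v| + 1).
have d0 : 0 < d by rewrite divr_gt0// ltr_wpDl.
have Os (s : R) : `|s| < d -> O (x + s *: v).
  move=> sd; apply: rP; rewrite -ball_normE /ball_/= opprD addrA subrr sub0r normrN normrZ.
  have v1 : 0 < `|v| + 1 by rewrite ltr_wpDl.
  move: sd; rewrite /d ltr_pdivlMr// mulrDr mulr1; have := normr_ge0 s; lra.
have OsN (s : R) : `|s| < d -> O (x + s *: - v).
  by move=> sd; rewrite scalerN -scaleNr; apply: Os; rewrite normrN.
have dfi i : differentiable (partial i f) x by apply: (proj1 (d2f i)).
pose g (s : R) := f (x + s *: v) + f (x + s *: (- v)).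
pose g' (s : R) := dotmul (gradient f (x + s *: v)) v +
  dotmul (gradient f (x + s *: (- v))) (- v).
suff: 0 <= dotmul (v *m hessian f x) v + dotmul (- v *m hessian f x) (- v).
  by rewrite mulNmx dotmulNr dotmulNl opprK -mulr2n pmulrn_lge0.
apply: (@second_derivative_ge0 R g g' _ d d0).
- move=> s sd; apply: is_deriveD; apply: is_derive_line; apply: df.
    exact: Os.
  exact: OsN.
- by apply: is_deriveD; apply: is_derive_gradient_line.
- move=> s sd; rewrite /g !scale0r !addr0.
  have := @convex_function_comb O f (x + s *: v) (x + s *: - v) 2^-1 cf (Os _ sd) (OsN _ sd) _.
  have -> : 2^-1 *: (x + s *: v) + (1 - 2^-1) *: (x + s *: - v) = x.
    by apply/rowP => k; rewrite !mxE; lra.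
  have -> : (1 - 2^-1 : R) = 2^-1 by lra.
  by rewrite -mulrDr => H; have := H (ltac:(lra)); lra.
Qed.

(** Once all entries are bounded by M, each of the n! terms of the Leibniz formula is at most M^n. A
    sharper inequality would only improve the dimensional constant. *)
Lemma psd_det_le (H : 'M[R]_n) (M : R) : H^T = H ->
  (forall v, 0 <= dotmul (v *m H) v) -> (forall i, H i i <= M) ->
  \det H <= n`!%:R * M ^+ n.
Proof.
move=> sH pH dH.
have HE i j : dotmul ('e_i *m H) 'e_j = H i j by rewrite dotmul_delta -rowE mxE.
(* Testing H on e_i + e_j and e_i - e_j bounds all its entries. *)
have Hij i j : `|H i j| <= M.
  have HC : H j i = H i j by rewrite -[in LHS]sH mxE.
  have := pH ('e_i + 'e_j); have := pH ('e_i - 'e_j).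
  rewrite mulmxBl mulmxDl !(dotmulDl, dotmulDr, dotmulNr, dotmulNl) !HE HC => H1 H2.
  by have := dH i; have := dH j; rewrite ler_norml => ? ?; apply/andP; split; lra.
rewrite /determinant; apply: (@le_trans _ _ (\sum_(s : 'S_n) M ^+ n)).
  apply: ler_sum => s _; rewrite (le_trans (ler_norm _))// normrMsign.
  rewrite normr_prod -[in leRHS](card_ord n) -prodr_const.
  by apply: ler_prod => i _; rewrite normr_ge0 Hij.
by rewrite sumr_const card_Sn mulr_natl.
Qed.

End second_order.

(** * Balls and the L^n norm *)

Section unit_ball.
Context {R : realType} {n : nat}.
Local Notation mu := (@lebesgue_rV R n).

Lemma measurable_unit_ball : measurable (@unit_ball R n).
Proof.
rewrite (_ : unit_ball = (fun x : 'rV[R]_n => dotmul x x) @^-1` `]-oo, 1[); last first.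
  by apply/seteqP; split => x /=; rewrite /unit_ball /= in_itv/= enorm_lt// expr1n.
rewrite -[X in measurable X]setTI; apply: (_ : measurable_fun setT _) => //.
by apply: measurable_sum => i; apply: measurable_funM; exact: measurable_rV_coord.
Qed.

Lemma lebesgue_rV_bounded (A : set 'rV[R]_n) : measurable A -> bounded_set A ->
  (mu A < +oo)%E.
Proof.
move=> mA [M [_ AM]]; pose r := `|M| + 1.
have r0 : 0 < r by rewrite ltr_wpDl.
apply: (@le_lt_trans _ _ (mu (cube (- const_mx r) (2 * r + 1)))).
  apply: le_measure; rewrite ?inE//; first exact: measurable_cube.
  move=> x Ax i; have xr : `|x| <= r by apply: AM => //; rewrite /r; have := ler_norm M; lra.
  have := le_trans (coord_le_norm x i) xr; rewrite ler_norml !mxE => /andP[? ?].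
  by apply/andP; split; lra.
by rewrite lebesgue_rV_cube ?ltry//; lra.
Qed.

Lemma lebesgue_rV_open_gt0 (O : set 'rV[R]_n) : open O -> O !=set0 -> (0 < mu O)%E.
Proof.
move=> oO [x Ox]; have mO := open_rV_measurable oO.
have /nbhs_ballP[r /= r0 rP] : nbhs x O by exact: open_nbhs_nbhs.
apply: (@lt_le_trans _ _ (mu (cube x r))).
  by rewrite lebesgue_rV_cube// lte_fin exprn_gt0.
apply: le_measure; rewrite ?inE//; first exact: measurable_cube.
move=> y xy; apply: rP; rewrite -ball_normE /ball_/= distrC; apply: cube_norm_lt xy => //.
by move=> i; rewrite lexx ltrDl.
Qed.

Lemma bounded_unit_ball : bounded_set (@unit_ball R n).
Proof.
exists 1; split => // M M1 x; rewrite /unit_ball /= enorm_lt// expr1n => x1.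
apply: rV_norm_le; first by rewrite ltW// (lt_trans _ M1).
by move=> i; rewrite (le_trans _ (ltW M1))// coord_le1// ltW.
Qed.

Lemma unit_ball_lty : (mu unit_ball < +oo)%E.
Proof. exact: lebesgue_rV_bounded measurable_unit_ball bounded_unit_ball. Qed.

Lemma volume_unit_ball_gt0 : 0 < volume (@unit_ball R n).
Proof.
apply: fine_gt0; rewrite unit_ball_lty andbT.
(* On the cube of side 1 / (n + 1) at the origin the sum of squares is at most n / (n + 1) < 1. *)
pose h : R := n.+1%:R^-1.
have h0 : 0 < h by rewrite invr_gt0.
apply: (@lt_le_trans _ _ (mu (cube 0 h))).
  by rewrite lebesgue_rV_cube// lte_fin exprn_gt0.
apply: le_measure; rewrite ?inE//; [exact: measurable_cube|exact: measurable_unit_ball|].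
move=> x xh; rewrite /unit_ball /= enorm_lt// expr1n.
have h1 : h <= 1 by rewrite invf_le1// ler1n.
apply: (@le_lt_trans _ _ (\sum_(i < n) h)).
  apply: ler_sum => i _; have := xh i; rewrite mxE add0r => /andP[? ?].
  rewrite -[leRHS]mulr1; apply: ler_pM => //; first exact: ltW.
  by apply: le_trans h1; exact: ltW.
by rewrite sumr_const card_ord -mulr_natr /h mulrC ltr_pdivrMr// mul1r ltr_nat.
Qed.

Lemma ball_enormE (m : R) : 0 < m -> [set p : 'rV[R]_n | enorm p < m] =
  [set p | unit_ball (p *m (m^-1)%:M + 0)].
Proof.
move=> m0; apply/seteqP; split => p /=;
  by rewrite addr0 mul_mx_scalar /unit_ball /= enormZ gtr0_norm ?invr_gt0//
    mulrC ltr_pdivrMr// mul1r.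
Qed.

Lemma measurable_ball_enorm (m : R) : 0 < m ->
  measurable [set p : 'rV[R]_n | enorm p < m].
Proof.
by move=> /ball_enormE ->; apply: measurable_rV_affine_preimage; exact: measurable_unit_ball.
Qed.

Lemma lebesgue_rV_ball_enorm (m : R) : 0 < m ->
  mu [set p : 'rV[R]_n | enorm p < m] = (volume (@unit_ball R n) * m ^+ n)%:E.
Proof.
move=> m0; rewrite ball_enormE// lebesgue_rV_affine; last 2 first.
- by rewrite unitmxE det_scalar unitrX// unitfE invr_neq0// gt_eqF.
- exact: measurable_unit_ball.
rewrite det_scalar normrX gtr0_norm ?invr_gt0// exprVn invrK mulrC EFinM.
by rewrite /volume fineK// ge0_fin_numE ?unit_ball_lty.
Qed.

Lemma Lpnorm_ge0 (p : R) (O : set 'rV[R]_n) u : 0 <= Lpnorm p O u.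
Proof. by apply: fine_ge0; exact: Lnorm_ge0. Qed.

Lemma Lpnorm_expn (O : set 'rV[R]_n) u : (0 < n)%N -> measurable O ->
  (Lpnorm n%:R O u) ^+ n = fine (\int[mu]_(x in O) (`|u x| ^+ n)%:E).
Proof.
move=> n0 mO; have nR0 : n%:R != 0 :> R by rewrite pnatr_eq0 -lt0n.
rewrite -powR_mulrn ?Lpnorm_ge0// /Lpnorm -fine_poweR poweR_Lnorm//.
congr fine; rewrite [RHS]integral_mkcond; apply: eq_integral => x _.
rewrite /= /patch; case: ifP => _.
  by rewrite powR_mulrn.
by rewrite normr0 powR0.
Qed.

End unit_ball.

(** * Negativity of the solution *)

Section domain.
Context {R : realType} {n : nat}.
Implicit Types (O : set 'rV[R]_n) (u : 'rV[R]_n -> R) (x y p : 'rV[R]_n).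

Lemma compact_closure O : bounded_set O -> compact (closure O).
Proof.
move=> [M [Mr OM]]; apply: bounded_closed_compact; last exact: closed_closure.
exists M; split => // N MN x.
have cN : closed [set y : 'rV[R]_n | `|y| <= N].
  rewrite (_ : mkset _ = (fun y : 'rV[R]_n => `|y|) @^-1` [set r | r <= N])//.
  by apply: closed_comp => [y _|]; [exact: norm_continuous|exact: closed_le].
rewrite -[X in _ -> X]/([set y : 'rV[R]_n | `|y| <= N] x) [X in _ -> X x](closure_id _).1//.
by move: x; apply: closure_subset => x /OM; exact.
Qed.

Lemma boundary_open O x : open O -> closure O x -> ~ O x -> boundary O x.
Proof. by move=> oO cx Ox; split => //; rewrite (interior_id _).1. Qed.

Lemma open_line O x v : open O -> O x ->
  exists2 d : R, 0 < d & forall s : R, `|s| < d -> O (x + s *: v).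
Proof.
move=> oO Ox; have /nbhs_ballP[r /= r0 rP] : nbhs x O by exact: open_nbhs_nbhs.
have v1 : 0 < `|v| + 1 by rewrite ltr_wpDl.
exists (r / (`|v| + 1)) => [|s sd]; first by rewrite divr_gt0.
apply: rP; rewrite -ball_normE /ball_/= opprD addrA subrr sub0r normrN normrZ.
by move: sd; rewrite ltr_pdivlMr// mulrDr mulr1; have := normr_ge0 s; lra.
Qed.

Lemma boundary_nonempty O : (0 < n)%N -> open O -> bounded_set O -> O !=set0 ->
  exists x, boundary O x.
Proof.
move=> n0 oO bO [x0 Ox0]; pose i := Ordinal n0.
have [x|z zO zmax] := @EVT_max_rV R n (fun y : 'rV[R]_n => y 0 i) (closure O)
    (ex_intro _ _ (subset_closure Ox0)) (compact_closure bO).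
  by apply: continuous_subspaceT => y; exact: coord_continuous.
rewrite inE in zO; exists z; apply: boundary_open => // Oz.
have [d d0 dP] := open_line ('e_i) oO Oz.
have Od : O (z + (d / 2) *: 'e_i) by apply: dP; rewrite gtr0_norm; lra.
have := zmax _ (mem_set (subset_closure Od)).
by rewrite !mxE !eqxx mulr1 gerDl leNgt divr_gt0.
Qed.

(** A positive maximum would be interior and force u to be constant in O, against its continuity at
    a boundary zero; hence u <= 0. Each x in O lies strictly between a point where u < 0 and another
    point of O, so convexity gives u x < 0. *)
Lemma convex_lt0 O u : (0 < n)%N -> open O -> bounded_set O ->
  {within closure O, continuous u} -> (forall x, boundary O x -> u x = 0) ->
  nonzero_convex O u -> forall x, O x -> u x < 0.
Proof.
move=> n0 oO bO cu ub [[x1 Ox1 ux1] cvxu].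
have [|xm xmO xmax] := EVT_max_rV _ (compact_closure bO) cu.
  by exists x1; exact: subset_closure.
rewrite inE in xmO.
have xmax' y : closure O y -> u y <= u xm by move=> ?; apply: xmax; rewrite inE.
have between x y : O x -> O y -> exists2 s : R, 0 < s < 1 &
    exists2 z, O z & u x <= s * u y + (1 - s) * u z.
  (* The point z is taken slightly beyond x on the ray from y. *)
  move=> Ox Oy; have [d d0 dP] := open_line (x - y) oO Ox.
  pose t := d / 2; have t0 : 0 < t by rewrite divr_gt0.
  have td : O (x + t *: (x - y)) by apply: dP; rewrite gtr0_norm// /t; lra.
  have t1 : 0 < 1 + t by lra.
  exists (t / (1 + t)).
    by rewrite divr_gt0//= ltr_pdivrMr// mul1r ltrDr.
  exists (x + t *: (x - y)) => //.
  apply: le_trans (convex_function_comb cvxu Oy td _); last first.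
    apply/andP; split; first by rewrite divr_ge0// ltW.
    by rewrite ler_pdivrMr// mul1r lerDr.
  suff -> : t / (1 + t) *: y + (1 - t / (1 + t)) *: (x + t *: (x - y)) = x by [].
  by apply/rowP => k; rewrite !mxE; field; lra.
have u_le0 : u xm <= 0.
  rewrite leNgt; apply/negP => uxm0.
  have Oxm : O xm.
    apply: contrapT => nO; have := ub _ (boundary_open oO xmO nO).
    by move=> u0; rewrite u0 ltxx in uxm0.
  have uc y : O y -> u y = u xm.
    move=> Oy; have [s /andP[s0 s1] [z Oz uz]] := between _ _ Oxm Oy.
    have uy := xmax' _ (subset_closure Oy); have uz' := xmax' _ (subset_closure Oz).
    apply/eqP; rewrite eq_le uy /=; nra.
  have [b bO'] := boundary_nonempty n0 oO bO (ex_intro _ _ Ox1).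
  have /subspace_continuousP/(_ b bO'.1) cub := cu.
  have : \forall y \near b, closure O y -> u y < u xm.
    have ub0 : u b < u xm by rewrite (ub _ bO').
    by have := cub; move/cvgr_lt; apply; exact: ub0.
  move=> nb; have [y [Oy uy]] := bO'.1 _ nb.
  by have := uy (subset_closure Oy); rewrite uc// ltxx.
have u_neg x : O x -> u x <= 0.
  by move=> Ox; apply: le_trans u_le0; exact/xmax'/subset_closure.
have ux1_lt0 : u x1 < 0 by rewrite lt_neqAle ux1 u_neg.
move=> x Ox; have [s /andP[s0 s1] [z Oz uz]] := between _ _ Ox Ox1.
have := u_neg _ Oz; nra.
Qed.

End domain.

(** * The gradient image *)

Section boundary_gradient.
Context {R : realType} {n : nat}.
Implicit Types (O : set 'rV[R]_n) (u rho : 'rV[R]_n -> R).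
Implicit Types (G : 'rV[R]_n -> 'rV[R]_n) (x y p d : 'rV[R]_n).

Lemma cvg_dotmul {T : Type} {F : set_system T} {FF : Filter F}
    (f g : T -> 'rV[R]_n) a b :
  f @ F --> a -> g @ F --> b -> dotmul (f x) (g x) @[x --> F] --> dotmul a b.
Proof.
move=> fa gb; rewrite /dotmul; elim: (index_enum _) => [|i s IH].
  rewrite big_nil; under eq_fun do rewrite big_nil; exact: cvg_cst.
rewrite big_cons; under eq_fun do rewrite big_cons.
apply: cvgD; last exact: IH.
have coord (h : T -> 'rV[R]_n) (c : 'rV[R]_n) : h @ F --> c -> h x 0 i @[x --> F] --> c 0 i.
  move=> hc; apply: (@cvg_comp _ _ _ h (fun M : 'rV[R]_n => M 0 i) _ _ _ hc).
  exact: coord_continuous.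
by apply: cvgM; exact: coord.
Qed.

Lemma inward_direction O x rho d : open O -> boundary O x ->
  defining_function O x rho -> dotmul (gradient rho x) d < 0 ->
  exists2 r : R, 0 < r & forall s : R, 0 < s < r -> O (x + s *: d).
Proof.
move=> oO bx [U [oU Ux Srho nu0 UO]] dneg.
have drho : differentiable rho x by have [+ _] := Srho 1; apply.
have rho_le0 : rho x <= 0.
  rewrite leNgt; apply/negP => rho_gt0.
  have nx : \forall y \near x, U y /\ 0 < rho y.
    apply: filterI; first exact: open_nbhs_nbhs.
    by have := differentiable_continuous drho; move/cvgr_gt; apply.
  have [y [Oy [Uy rhoy]]] := bx.1 _ nx.
  by have := (UO _ Uy).1 Oy; rewrite ltNge ltW.
pose c := - dotmul (gradient rho x) d; have c0 : 0 < c by rewrite oppr_gt0.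
have d1 : 0 < `|d| + 1 by rewrite ltr_wpDl.
(* With this tolerance the error along s d is at most c s / 2, half of the first-order decrease c
   s. *)
have e0 : 0 < c / 2 / (`|d| + 1) by rewrite !divr_gt0.
have [r r0 rP] := differentiable_expansion drho e0.
have [r' r'0 r'P] := open_line d oU Ux.
pose m := Num.min (r / (`|d| + 1)) r'.
have m0 : 0 < m by rewrite lt_min divr_gt0.
exists m => // s /andP[s0]; rewrite lt_min => /andP[sr sr'].
have Us : U (x + s *: d) by apply: r'P; rewrite gtr0_norm.
apply/(UO _ Us); have := rP (x + s *: d).
have -> : x + s *: d - x = s *: d by rewrite addrC addKr.
rewrite normrZ gtr0_norm// dotmulZr => H.
have {}H := H (ltac:(by move: sr; rewrite ltr_pdivlMr// mulrDr mulr1; lra)).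
have {H} : `|rho (x + s *: d) - rho x - s * dotmul (gradient rho x) d| <= c / 2 * s.
  apply: (le_trans H).
  have -> : c / 2 / (`|d| + 1) * (s * `|d|) = (c / 2 * s) * (`|d| / (`|d| + 1)) by ring.
  rewrite ler_piMr//; first by rewrite !mulr_ge0// ltW.
  by rewrite ler_pdivrMr// mul1r lerDl.
rewrite ler_norml => /andP[_]; rewrite -[dotmul _ _]opprK -/c.
by have := mulr_gt0 c0 s0; lra.
Qed.

(** At a boundary point the derivatives of u may not exist. The mean value theorem on the segment,
    whose interior lies in O, and the continuity of G at x replace them. *)
Lemma boundary_expansion O u G x d (r : R) :
  {within closure O, continuous u} -> {within closure O, continuous G} ->
  (forall y, O y -> differentiable u y) -> (forall y, O y -> G y = gradient u y) ->
  closure O x -> 0 < r -> (forall s : R, 0 < s < r -> O (x + s *: d)) ->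
  forall e : R, 0 < e -> exists2 s1 : R, 0 < s1 <= r & forall s : R, 0 < s < s1 ->
    `|u (x + s *: d) - u x - s * dotmul (G x) d| <= e * s.
Proof.
move=> /subspace_continuousP cu /subspace_continuousP cG du GE cx r0 rO e e0.
have lc (t : R) : x + s *: d @[s --> t] --> x + t *: d.
  by apply: cvgD; [exact: cvg_cst|apply: cvgZr_tmp; exact: cvg_id].
have clO s : 0 <= s < r -> closure O (x + s *: d).
  move=> /andP[]; rewrite le_eqVlt => /predU1P[<- _|s0 sr].
    by rewrite scale0r addr0.
  by apply: subset_closure; apply: rO; rewrite s0.
have nG : \forall y \near x, closure O y -> `|dotmul (G y) d - dotmul (G x) d| < e.
  have : dotmul (G y) d @[y --> within (closure O) (nbhs x)] --> dotmul (G x) d.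
    by apply: cvg_dotmul; [exact: cG|exact: cvg_cst].
  move/cvgrPdist_lt => /(_ _ e0) nd.
  by apply: filterS nd => y; rewrite distrC.
have : \forall s \near (0 : R), closure O (x + s *: d) ->
    `|dotmul (G (x + s *: d)) d - dotmul (G x) d| < e.
  by have := lc 0; rewrite scale0r addr0 => /(_ _ nG).
move=> /nbhs_ballP[s1 /= s10 s1P].
exists (Num.min s1 r); first by rewrite lt_min s10 r0 ge_min lexx orbT.
move=> s /andP[s0]; rewrite lt_min => /andP[ss1 sr].
pose phi (t : R) := u (x + t *: d).
have [||t] := @MVT R phi (fun t => dotmul (gradient u (x + t *: d)) d) 0 s s0.
- move=> t; rewrite in_itv/= => /andP[t0 ts]; apply: is_derive_line; apply: du.
  by apply: rO; rewrite t0 (lt_trans ts).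
(* At t = 0 the point may lie on the boundary, so continuity is inherited from that of u within
   [closure O]. *)
- apply/subspace_continuousP => t; rewrite /= in_itv/= => /andP[t0 ts].
  apply: (@cvg_comp _ _ _ (fun t : R => x + t *: d) u _ (within (closure O) (nbhs (x + t *: d)))).
    move=> A nA.
    have {}nA : \forall t' \near t, closure O (x + t' *: d) -> A (x + t' *: d).
      exact: (lc t _ nA).
    change (\forall t' \near t, `[0, s]%classic t' -> A (x + t' *: d)).
    near=> t'; rewrite /= in_itv/= => /andP[t'0 t's].
    have At' : closure O (x + t' *: d) -> A (x + t' *: d) by near: t'.
    by apply: At'; apply: clO; rewrite t'0 (le_lt_trans t's).
  by apply: cu; apply: clO; rewrite t0 (le_lt_trans ts).
rewrite in_itv/= subr0 => /andP[t0 ts].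
rewrite /phi scale0r addr0 => ->.
rewrite [_ * s]mulrC -mulrBr normrM gtr0_norm// mulrC ler_pM2r//.
have tr : 0 < t < r by rewrite t0 (lt_trans ts).
rewrite -GE ?ltW//; last exact: rO.
apply: s1P; last by apply: clO; rewrite ltW//; case/andP: tr.
by rewrite /ball /= sub0r normrN gtr0_norm// (lt_trans ts).
Unshelve. all: by end_near. Qed.

Lemma gradient_extE O u G x : {within closure O, continuous G} ->
  (forall y, O y -> G y = gradient u y) -> closure O x ->
  gradient_ext O u x = G x.
Proof.
move=> /subspace_continuousP cG GE cx.
(* Properness makes limits along this filter unique, so [lim] picks the value of G. *)
have PF : ProperFilter (within O (nbhs x)) by exact: within_nbhs_proper.
apply: cvg_lim; first exact: norm_hausdorff.
move=> A nA.
have {}nA : \forall y \near x, closure O y -> A (G y) by exact: (cG _ cx _ nA).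
change (\forall y \near x, O y -> A (gradient u y)).
near=> y => Oy; rewrite -GE//.
have Ay : closure O y -> A (G y) by near: y.
by apply: Ay; exact: subset_closure.
Unshelve. all: by end_near. Qed.

(* The minimum of u - p.x is not attained on the boundary: there, with q the
   gradient of u, the inward directions -nu and -q - delta nu would give
   q.nu >= 0 and then |q|^2 <= p.q, hence |q| <= |p|. *)
Lemma gradient_image_ball O u (m : R) : open O -> bounded_set O -> O !=set0 ->
  smooth_boundary O -> C1_closure O u -> (forall x, boundary O x -> u x = 0) ->
  (forall x, O x -> u x < 0) ->
  (forall x, boundary O x -> m <= enorm (gradient_ext O u x)) ->
  [set p | enorm p < m] `<=` gradient u @` O.
Proof.
move=> oO bO [y0 Oy0] sO [[du _] cu [G cG GE]] ub uneg mle p /= pm.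
pose phi x := u x - dotmul p x.
have cphi : {within closure O, continuous phi}.
  apply/subspace_continuousP => x cx; apply: cvgB.
    by have /subspace_continuousP/(_ _ cx) := cu.
  apply: cvg_dotmul; first exact: cvg_cst.
  exact: cvg_within.
have [|x xO xmin] := EVT_min_rV _ (compact_closure bO) cphi.
  by exists y0; exact: subset_closure.
rewrite inE in xO.
have {}xmin y : closure O y -> phi x <= phi y by move=> ?; apply: xmin; rewrite inE.
have [Ox|nOx] := pselect (O x).
  exists x => //; apply/rowP => i.
  have [d d0 dP] := open_line ('e_i) oO Ox.
  pose g (s : R) := u (x + s *: 'e_i) + (- p 0 i) * s.
  have dg (s : R) : `|s| < d -> is_derive s 1 g (partial i u (x + s *: 'e_i) + - p 0 i).
    move=> /dP Os; apply: is_deriveD.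
      have -> : partial i u (x + s *: 'e_i) = dotmul (gradient u (x + s *: 'e_i)) 'e_i.
        by rewrite dotmul_delta mxE.
      by apply: is_derive_line; exact: du.
    apply: (is_derive_eq (is_deriveZ _ (is_derive_id _ _))).
    by rewrite /GRing.scale/= mulr1.
  have : is_derive (0 : R) 1 g 0.
    apply: (@derive1_at_min _ g (- d) d).
    - by rewrite ge0_cp// ltW.
    - by move=> t; rewrite in_itv/= -ltr_norml => /dg[].
    - by rewrite in_itv/= oppr_lt0 d0.
    - move=> t; rewrite in_itv/= -ltr_norml => /dP/subset_closure/xmin.
      rewrite /phi /g dotmulDr dotmulZr dotmul_delta scale0r addr0; lra.
  have := dg 0; rewrite normr0 => /(_ d0)[_ dgE] [_].
  by rewrite dgE scale0r addr0 mxE => /eqP; rewrite subr_eq0 => /eqP.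
have bx := boundary_open oO xO nOx.
have := mle _ bx; rewrite (gradient_extE cG GE xO); set q := G x => mq.
have [rho dfr] := sO _ bx; pose nu := gradient rho x.
have nu0 : 0 < dotmul nu nu by apply: dotmulvv_gt0; case: dfr => U [].
(* Along an inward direction, u < 0 = u x gives the first inequality and the minimality of [phi] at
   x the second. *)
have expand d : dotmul nu d < 0 -> dotmul q d <= 0 /\ dotmul p d <= dotmul q d.
  move=> dneg; have [r r0 rP] := inward_direction oO bx dfr dneg.
  have ex := boundary_expansion cu cG du GE xO r0 rP.
  suff : forall e : R, 0 < e -> dotmul q d <= e /\ dotmul p d - e <= dotmul q d.
    move=> H; split; apply/ler_addgt0Pr => e /H[]; lra.
  move=> e e0; have [s1 /andP[s10 s1r] s1P] := ex _ e0.
  pose s := s1 / 2; have s0 : 0 < s by rewrite divr_gt0.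
  have ss1 : s < s1 by rewrite /s; lra.
  have Os : O (x + s *: d) by apply: rP; rewrite s0 (lt_le_trans ss1).
  have := s1P s; rewrite s0 ss1 => /(_ isT).
  have us := uneg _ Os; have := xmin _ (subset_closure Os).
  rewrite /phi dotmulDr dotmulZr (ub _ bx) -/q ler_norml => H1 /andP[H2 H3].
  by split; rewrite -(ler_pM2l s0); lra.
have qnu : 0 <= dotmul q nu.
  have [|] := expand (- nu); first by rewrite dotmulNr oppr_lt0.
  by rewrite dotmulNr oppr_le0.
have qp : dotmul q q <= dotmul p q.
  apply/ler_addgt0Pr => e e0.
  (* With delta = e / k the contribution of delta nu to the comparison of p and q is at most e. *)
  pose k := `|dotmul q nu - dotmul p nu| + 1.
  have k0 : 0 < k by rewrite ltr_wpDl.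
  pose dl := e / k; have dl0 : 0 < dl by rewrite divr_gt0.
  have [|_] := expand (- q - dl *: nu).
    rewrite dotmulBr dotmulNr dotmulZr (dotmulC nu q).
    by have := mulr_gt0 dl0 nu0; lra.
  rewrite !dotmulBr !dotmulNr !dotmulZr => H.
  have : dl * (dotmul p nu - dotmul q nu) <= e.
    rewrite /dl mulrAC ler_pdivrMr// ler_pM2l// /k distrC.
    by rewrite (le_trans (ler_norm _))// lerDl.
  have : - (dl * k) <= dl * (dotmul p nu - dotmul q nu).
    rewrite -mulrN ler_pM2l// /k distrC.
    by have := ler_norm (- (dotmul p nu - dotmul q nu)); rewrite normrN; lra.
  have -> : dl * k = e by rewrite /dl divfK// gt_eqF.
  lra.
(* Together with q.q <= p.q, expanding |p - q|^2 >= 0 gives |q| <= |p| and plays the part of the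
   Cauchy-Schwarz inequality. *)
have := dotmulvv_ge0 (p - q).
rewrite dotmulBl !dotmulBr (dotmulC q p) -!sqr_enorm in qp *.
have mp : enorm p < enorm q := lt_le_trans pm mq.
have : enorm p ^+ 2 < enorm q ^+ 2 by rewrite ltr_pXn2r// nnegrE enorm_ge0.
lra.
Qed.

End boundary_gradient.

(** * Touching on an ellipsoid *)

Section ellipsoid.
Context {R : realType} {n : nat}.
Implicit Types (O : set 'rV[R]_n) (u : 'rV[R]_n -> R) (x y z : 'rV[R]_n) (A B : 'M[R]_n).

Let ball1 : set 'rV[R]_n := [set y | dotmul y y <= 1].

Lemma compact_ball1 : compact ball1.
Proof.
apply: bounded_closed_compact.
  exists 1; split => // M M1 x x1; apply: rV_norm_le; first by rewrite ltW// (lt_trans _ M1).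
  by move=> i; rewrite (le_trans _ (ltW M1))// coord_le1.
rewrite (_ : ball1 = (fun y : 'rV[R]_n => dotmul y y) @^-1` [set r | r <= 1])//.
apply: closed_comp => [y _|]; last exact: closed_le.
have cid : (fun y' : 'rV[R]_n => y') @ y --> y by exact: cvg_id.
exact: (cvg_dotmul cid cid).
Qed.

Lemma mulmx_continuous m (M : 'M[R]_(n, m)) x : y *m M @[y --> x] --> x *m M.
Proof.
have [c c0 cM] := mulmx_norm_le M.
move=> A /nbhs_ballP[e /= e0 eA]; apply/nbhs_ballP.
exists (e / c) => [|y]; first by rewrite /= divr_gt0.
rewrite -ball_normE /ball_/= ltr_pdivlMr// => xy; apply: eA.
by rewrite -ball_normE /ball_/= -mulmxBl (le_lt_trans (cM _))// mulrC.
Qed.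

(** The restriction of (1 - |y|^2)^2 to the line through y along e_i, where q = 1 - |y|^2 and a =
    y_i. As a polynomial it is differentiated formally. *)
Let bump (q a : R) : {poly R} := (q%:P - (2 * a) *: 'X - 'X^2) ^+ 2.

Let bumpE q a s : (bump q a).[s] = (q - 2 * a * s - s ^+ 2) ^+ 2.
Proof. by rewrite /bump !hornerE. Qed.

Let bump''0 q a : (bump q a)^`()^`().[0] = 8 * a ^+ 2 - 4 * q.
Proof.
rewrite /bump expr2 !(derivM, derivN, derivB, derivD, derivZ, derivX, derivXn, derivC, derivMn).
rewrite !hornerE /=; ring.
Qed.

(* At the maximum of (1 - |y|^2)^2 / -u(z + yB), the bump of the right size
   touches -u from below; comparing second derivatives bounds the Hessian of u,
   hence its determinant lambda |u|^n. *)
Lemma MA_eigenvalue_ellipsoid O u (lambda : R) z B : (0 < n)%N -> open O ->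
  0 < lambda -> Ck 2 O u -> @convex_function R 'rV[R]_n O u ->
  (forall x, O x -> u x < 0) ->
  (forall x, O x -> \det (hessian u x) = lambda * `|u x| ^+ n) ->
  (forall y, dotmul y y <= 1 -> O (z + y *m B)) ->
  lambda * \det B ^+ 2 <= n`!%:R * (2 * (n%:R + 2)) ^+ n.
Proof.
move=> n0 oO l0 C2u cvxu uneg detu OB.
have [du /= d2u] := C2u.
pose Q (y : 'rV[R]_n) := (1 - dotmul y y) ^+ 2 / - u (z + y *m B).
have cQ : {within ball1, continuous Q}.
  apply/subspace_continuousP => y yB; have Oy := OB _ yB.
  have cy : dotmul y' y' @[y' --> within ball1 (nbhs y)] --> dotmul y y.
    by apply: cvg_dotmul; exact: cvg_within.
  apply: cvgM.
    apply: (@cvg_comp _ _ _ (fun y' : 'rV[R]_n => 1 - dotmul y' y') (fun r : R => r ^+ 2)).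
      by apply: cvgB; [exact: cvg_cst|exact: cy].
    exact: exprn_continuous.
  apply: cvgV; first by rewrite oppr_eq0 lt_eqF// uneg.
  apply: cvgN; apply: (@cvg_comp _ _ _ (fun y' : 'rV[R]_n => z + y' *m B) u _ (nbhs (z + y *m B))).
    apply: cvgD; first exact: cvg_cst.
    apply: (@cvg_comp _ _ _ id (fun y' => y' *m B) _ (nbhs y)); first exact: cvg_within.
    exact: mulmx_continuous.
  exact: differentiable_continuous (du _ Oy).
have d00 : dotmul (0 : 'rV[R]_n) 0 = 0.
  by apply: big1 => i _; rewrite mxE mul0r.
have [|y] := EVT_max_rV _ compact_ball1 cQ.
  by exists 0; rewrite /ball1 /= d00 ler01.
rewrite inE => yB ymax.
have {}ymax y' : ball1 y' -> Q y' <= Q y by move=> ?; apply: ymax; rewrite inE.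
pose x := z + y *m B; have Ox : O x by exact: OB.
pose q := 1 - dotmul y y; pose t := - u x / q ^+ 2.
have ux0 : 0 < - u x by rewrite oppr_gt0 uneg.
have Qy0 : 0 < Q y.
  apply: lt_le_trans (ymax 0 _); last by rewrite /ball1 /= d00 ler01.
  by rewrite /Q d00 subr0 expr1n divr_gt0// oppr_gt0 uneg//; apply: OB; rewrite d00 ler01.
have q_neq0 : q != 0.
  by apply: contraTneq Qy0 => q0; rewrite /Q -/q q0 expr0n/= mul0r ltxx.
have q0 : 0 < q by rewrite lt_neqAle eq_sym q_neq0 subr_ge0.
have q1 : q <= 1 by rewrite gerBl dotmulvv_ge0.
have q20 : 0 < q ^+ 2 by rewrite exprn_gt0.
have t0 : 0 < t by rewrite divr_gt0.
have touch y' : ball1 y' -> t * (1 - dotmul y' y') ^+ 2 <= - u (z + y' *m B).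
  move=> y'B; have := ymax _ y'B; rewrite /Q -/x -/q.
  have u'0 : 0 < - u (z + y' *m B) by rewrite oppr_gt0 uneg//; exact: OB.
  rewrite ler_pdivrMr// => H.
  apply: (le_trans (ler_wpM2l (ltW t0) H)).
  rewrite /t le_eqVlt; apply/orP; left; apply/eqP; field.
  by rewrite q_neq0 -oppr_eq0 gt_eqF.
(* The Hessian of [u (z + y *m B)] as a function of y. *)
pose H := B *m hessian u x *m B^T.
have HE v : dotmul (v *m H) v = dotmul (v *m B *m hessian u x) (v *m B).
  rewrite /H !mulmxA; set w := v *m B *m hessian u x.
  rewrite /dotmul.
  transitivity ((w *m B^T *m v^T) 0 0).
    by rewrite [RHS]mxE; apply: eq_bigr => k _; rewrite [v^T _ _]mxE.
  rewrite -mulmxA -trmx_mul [LHS]mxE; apply: eq_bigr => k _.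
  by rewrite [(v *m B)^T _ _]mxE.
have pH v : 0 <= dotmul (v *m H) v.
  by rewrite HE; exact: (convex_hessian_ge0 _ oO Ox C2u cvxu).
have sH : H^T = H.
  by rewrite /H !trmx_mul trmxK (hessian_sym oO Ox C2u) mulmxA.
have HiiE i : H i i = dotmul (row i B *m hessian u x) (row i B).
  by rewrite rowE -HE dotmul_delta -rowE [RHS]mxE.
have Hii i : H i i <= t * (4 * q - 8 * y 0 i ^+ 2).
  pose b := row i B.
  have [d d0 dP] := open_line b oO Ox.
  (* For |s| <= q / 3 the increment 2 y_i s + s^2 of |y|^2 is at most 3 |s| <= q, so the shifted
     point stays in the closed unit ball. *)
  pose dq := Num.min d (q / 3).
  have dq0 : 0 < dq by rewrite lt_min d0 divr_gt0.
  pose p := bump q (y 0 i).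
  pose g (s : R) := - u (x + s *: b) - t * p.[s].
  pose g' (s : R) := - dotmul (gradient u (x + s *: b)) b - t * p^`().[s].
  have dpoly (r : {poly R}) (s : R) :
      is_derive s 1 (fun s : R => t * r.[s]) (t * r^`().[s]).
    exact: (@is_deriveZ _ _ _ (horner r) t s 1 r^`().[s] (is_derive_poly r s)).
  have : 0 <= - dotmul (b *m hessian u x) b - t * p^`()^`().[0].
    apply: (@second_derivative_ge0 R g g' _ dq dq0).
    - move=> s; rewrite lt_min => /andP[sd _].
      by apply: is_deriveB; apply/is_deriveN/is_derive_line/du/dP.
    - apply: is_deriveB; apply/is_deriveN/is_derive_gradient_line => j.
      exact: (proj1 (d2u j)).
    - move=> s; rewrite lt_min => /andP[sd sq].
      have ss : s ^+ 2 <= `|s|.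
        rewrite -real_normK ?num_real// expr2 ler_piMr//; lra.
      have yE : dotmul (y + s *: 'e_i) (y + s *: 'e_i) = dotmul y y + 2 * y 0 i * s + s ^+ 2.
        rewrite !(dotmulDl, dotmulDr, dotmulZl, dotmulZr) (dotmulC 'e_i y) !dotmul_delta.
        by rewrite mxE !eqxx /=; ring.
      have y1 : `|y 0 i| <= 1 by exact: coord_le1.
      have ys : y 0 i * s <= `|s|.
        by rewrite (le_trans (ler_norm _))// normrM ler_piMl.
      have yB' : ball1 (y + s *: 'e_i).
        by rewrite /ball1 /= yE; move: sq; rewrite /q; lra.
      have := touch _ yB'.
      have -> : z + (y + s *: 'e_i) *m B = x + s *: b.
        by rewrite mulmxDl -scalemxAl -rowE addrA.
      rewrite yE /g /p !bumpE scale0r addr0 mulr0 expr0n /= !subr0.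
      have -> : 1 - (dotmul y y + 2 * y 0 i * s + s ^+ 2) = q - 2 * y 0 i * s - s ^+ 2.
        by rewrite /q; ring.
      have -> : t * q ^+ 2 = - u x by rewrite /t divfK// gt_eqF.
      lra.
  by rewrite /p bump''0 HiiE -/b; lra.
(* The trace of H is nonnegative by convexity and at most t (4 n q - 8 |y|^2), whence 2 (1 - q) <= n
   q. This is where the square in the bump is used. *)
have qn : 2 / (n%:R + 2) <= q.
  have : 0 <= \sum_i H i i.
    by apply: sumr_ge0 => i _; rewrite HiiE; exact: (convex_hessian_ge0 _ oO Ox C2u cvxu).
  have : \sum_i H i i <= t * (4 * n%:R * q - 8 * dotmul y y).
    apply: (le_trans (ler_sum _ (fun i _ => Hii i))).
    rewrite -mulr_sumr ler_pM2l// sumrB sumr_const card_ord -mulr_natr /dotmul mulr_sumr.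
    rewrite le_eqVlt; apply/orP; left; apply/eqP; by congr (_ - _); ring.
  move=> /[swap] /le_trans /[apply]; rewrite pmulr_rge0// => yq.
  have n2 : 0 < n%:R + 2 :> R by rewrite ltr_wpDl.
  rewrite ler_pdivrMr//.
  by move: yq; rewrite (_ : dotmul y y = 1 - q); [lra|rewrite /q; ring].
have n20 : 0 < n%:R + 2 :> R by rewrite ltr_wpDl.
have Hii4 i : H i i <= 4 * q * t.
  apply: (le_trans (Hii i)).
  by have := mulr_ge0 (ltW t0) (sqr_ge0 (y 0 i)); lra.
have := psd_det_le sH pH Hii4.
rewrite /H !det_mulmx det_tr detu//.
have -> : `|u x| = t * q ^+ 2.
  by rewrite ltr0_norm ?uneg// /t divfK// gt_eqF.
move=> HD.
(* As |u x| = t q^2, the determinant bound reads lambda (det B)^2 (t q^2)^n <= n! (4 q t)^n;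
   cancelling (t q)^n removes the normalisation of u. *)
have tq0 : 0 < t * q by rewrite mulr_gt0.
have {}HD : lambda * \det B ^+ 2 * q ^+ n <= n`!%:R * 4 ^+ n.
  rewrite -(ler_pM2r (exprn_gt0 n tq0)).
  move: HD; rewrite [q ^+ 2]expr2 !exprMn => HD.
  move: HD; congr (_ <= _); ring.
have qn0 : 0 < q ^+ n by rewrite exprn_gt0.
rewrite -(ler_pM2r qn0) (le_trans HD)//.
rewrite -mulrA ler_pM2l ?ltr0n ?fact_gt0// -exprMn.
have q4 : 4 <= 2 * (n%:R + 2) * q by move: qn; rewrite ler_pdivrMr//; lra.
by apply: lerXn2r => //; rewrite nnegrE// (le_trans _ q4).
Qed.

End ellipsoid.

(** * Large inscribed simplices *)

Section simplex.
Context {R : realType} {n : nat}.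
Implicit Types (O : set 'rV[R]_n) (x y v c : 'rV[R]_n) (A : 'M[R]_n).

Lemma convex_combination O v (I : Type) (s : seq I) (w : I -> R) (p : I -> 'rV[R]_n) :
  @convex_set R 'rV[R]_n O -> O v -> (forall i, O (v + p i)) ->
  (forall i, 0 <= w i) -> \sum_(i <- s) w i <= 1 ->
  O (v + \sum_(i <- s) w i *: p i).
Proof.
move=> cO Ov Op w0 w1.
(* Generalised to any bound t on the total weight, for the induction; the missing weight goes to v.
   The case t = 0 is apart, since one divides by t. *)
suff H t : \sum_(i <- s) w i <= t -> 0 <= t -> exists2 d, O (v + d) &
    \sum_(i <- s) w i *: p i = t *: d.
  by have [d Od ->] := H _ w1 ler01; rewrite scale1r.
elim: s t {w1} => [|i s IH] t.
  by move=> _ _; exists 0; rewrite ?addr0// big_nil scaler0.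
rewrite !big_cons => wt t0.
have s0 : 0 <= \sum_(j <- s) w j by exact: sumr_ge0.
have wt' : \sum_(j <- s) w j <= t - w i by rewrite lerBrDl.
have [d Od ->] := IH _ wt' (le_trans s0 wt').
move: t0; rewrite le_eqVlt => /predU1P[t0|t0].
  have wi0 : w i = 0.
    by apply/eqP; rewrite eq_le w0 andbT t0 (le_trans _ wt)// lerDl.
  by exists 0; rewrite ?addr0// -t0 wi0 subr0 !scale0r addr0.
exists ((w i / t) *: p i + (1 - w i / t) *: d).
  have -> : v + ((w i / t) *: p i + (1 - w i / t) *: d) =
      (w i / t) *: (v + p i) + (1 - w i / t) *: (v + d).
    by apply/rowP => k; rewrite !mxE; ring.
  apply: convex_set_comb => //; rewrite divr_ge0 ?w0 ?(ltW t0)//=.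
  by rewrite ler_pdivrMr// mul1r; lra.
by apply/rowP => k; rewrite !mxE; field; rewrite gt_eqF.
Qed.

Lemma bounded_setB O v : bounded_set O -> exists M : R, forall x, O x -> `|x - v| <= M.
Proof.
move=> [M [_ OM]]; exists (`|M| + 1 + `|v|) => x Ox.
rewrite (le_trans (ler_normB _ _))// lerD2r; apply: OM => //.
by rewrite (le_lt_trans (ler_norm _))// ltrDl.
Qed.

(* Take a simplex with vertex v whose volume is more than half of the supremum:
   by Cramer's rule, the coordinates of x - v in its edges are the factors by
   which moving another vertex to x multiplies the volume. *)
Lemma large_simplex O v : open O -> bounded_set O -> O v ->
  exists A, [/\ A \in unitmx, forall i, O (v + row i A) &
    forall x, O x -> forall i, `|((x - v) *m invmx A) 0 i| < 2].
Proof.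
move=> oO bO Ov.
pose S := [set `|\det A| | A in [set A | forall i, O (v + row i A)]].
have [M OM] := bounded_setB v bO.
have ubS : has_ubound S.
  exists (\sum_(s : 'S_n) M ^+ n) => _ [A OA <-].
  rewrite /determinant (le_trans (ler_norm_sum _ _ _))//; apply: ler_sum => s _.
  rewrite normrMsign normr_prod -[in leRHS](card_ord n) -prodr_const.
  apply: ler_prod => i _; rewrite normr_ge0/=.
  have := OM _ (OA i); rewrite addrC addKr; apply: le_trans.
  by have := coord_le_norm (row i A) (s i); rewrite mxE.
have [A0 A0S A0det] : exists2 A, (forall i, O (v + row i A)) & 0 < `|\det A|.
  have /nbhs_ballP[r /= r0 rP] : nbhs v O by exact: open_nbhs_nbhs.
  exists (r / 2)%:M => [i|]; last by rewrite normr_gt0 det_scalar expf_neq0//; lra.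
  apply: rP; rewrite -ball_normE /ball_/= opprD addrA subrr sub0r normrN.
  apply: rV_norm_lt => // j; rewrite !mxE; case: eqP => _; rewrite ?mulr1n ?mulr0n ?normr0//.
  by rewrite gtr0_norm; lra.
have supS : has_sup S by split => //; exists `|\det A0|; exists A0.
have sup0 : 0 < sup S.
  by apply: lt_le_trans A0det _; apply: ub_le_sup => //; exists A0.
have [_ [A OA <-] supA] := @sup_adherent _ S (sup S / 2) (ltac:(lra)) supS.
have detA0 : 0 < `|\det A| by lra.
have Au : A \in unitmx by rewrite unitmxE unitfE -normr_gt0.
exists A; split => // x Ox i.
(* The edge of index i is replaced by x - v; expanding along that row produces the adjugate, hence
   the coordinate of x - v. *)
pose A' := \matrix_(k, j) (if k == i then (x - v) 0 j else A k j).
have detA' : \det A' = \det A * ((x - v) *m invmx A) 0 i.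
  rewrite (expand_det_row _ i) /invmx Au -scalemxAr mxE mulrA mulfV ?mul1r; last first.
    by rewrite -normr_gt0.
  rewrite mxE; apply: eq_bigr => j _; rewrite [A' i j]mxE eqxx; congr (_ * _).
  rewrite [RHS]mxE /cofactor; congr (_ * \det _).
  by apply/matrixP => k l; rewrite !mxE eq_sym (negPf (neq_lift _ _)).
have : `|\det A'| <= sup S.
  apply: ub_le_sup => //; exists A' => //= k.
  have [->|ki] := eqVneq k i.
    have -> : row i A' = x - v by apply/rowP => j; rewrite !mxE eqxx.
    by rewrite addrC subrK.
  have -> : row k A' = row k A by apply/rowP => j; rewrite !mxE (negPf ki).
  exact: OA.
rewrite detA' normrM => H.
rewrite -(ltr_pM2l detA0) (le_lt_trans H)//; lra.
Qed.

Lemma volume_large_simplex O v A : measurable O -> A \in unitmx ->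
  (forall x, O x -> forall i, `|((x - v) *m invmx A) 0 i| < 2) ->
  (lebesgue_rV n O <= (4 ^+ n * `|\det A|)%:E)%E.
Proof.
move=> mO Au OA.
have Au' : invmx A \in unitmx by rewrite unitmx_inv.
apply: (@le_trans _ _ (lebesgue_rV n
    [set y | cube (- const_mx 2) 4 (y *m invmx A + - (v *m invmx A))])).
  apply: le_measure; rewrite ?inE//.
    by apply: measurable_rV_affine_preimage; exact: measurable_cube.
  move=> x Ox i; have := OA x Ox i.
  rewrite -mulmxBl ltr_norml !mxE => /andP[? ?]; apply/andP; split; lra.
by rewrite lebesgue_rV_parallelepiped// lee_fin det_inv normrV ?invrK 1?mulrC//.
Qed.

(** Each point of the ellipsoid gives the edge of index i the weight (1 + y_i) / (2 n), which lies
    between 0 and 1 / n, so the weights are nonnegative with sum at most 1. *)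
Lemma simplex_ellipsoid O v A : (0 < n)%N -> @convex_set R 'rV[R]_n O -> O v ->
  (forall i, O (v + row i A)) -> forall y, dotmul y y <= 1 ->
  O (v + const_mx (2 * n%:R)^-1 *m A + y *m ((2 * n%:R)^-1 *: A)).
Proof.
move=> n0 cO Ov OA y y1.
have nR0 : 0 < n%:R :> R by rewrite ltr0n.
have yi i : `|y 0 i| <= 1 by exact: coord_le1.
pose w i := (2 * n%:R)^-1 * (1 + y 0 i).
have -> : v + const_mx (2 * n%:R)^-1 *m A + y *m ((2 * n%:R)^-1 *: A) =
    v + \sum_i w i *: row i A.
  rewrite -addrA; congr (_ + _); rewrite -scalemxAr scalemxAl -mulmxDl.
  rewrite mulmx_sum_row; apply: eq_bigr => i _; congr (_ *: _).
  by rewrite !mxE /w mulrDr mulr1.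
apply: convex_combination => // [i|].
  rewrite mulr_ge0 ?invr_ge0 ?mulr_ge0 ?(ltW nR0)//.
  by have := yi i; rewrite ler_norml; lra.
rewrite -mulr_sumr mulrC ler_pdivrMr ?mulr_gt0// mul1r.
apply: (@le_trans _ _ (\sum_(i < n) 2)).
  by apply: ler_sum => i _; have := yi i; rewrite ler_norml; lra.
by rewrite sumr_const card_ord mulr_natr.
Qed.

End simplex.

(** * Bounds on the eigenvalue *)

Section eigenvalue_bounds.
Context {R : realType} {n : nat}.
Implicit Types (O : set 'rV[R]_n) (u : 'rV[R]_n -> R).

(** The ellipsoid has matrix A / (2 n) while |O| <= 4^n |det A|; the two losses multiply to (8 n)^n,
    squared because det B enters squared. *)
Lemma MA_volume_bound O u (lambda : R) : (0 < n)%N -> open O -> bounded_set O ->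
  @convex_set R 'rV[R]_n O -> 0 < lambda -> Ck 2 O u ->
  @convex_function R 'rV[R]_n O u -> (forall x, O x -> u x < 0) ->
  (forall x, O x -> \det (hessian u x) = lambda * `|u x| ^+ n) -> O !=set0 ->
  lambda * volume O ^+ 2 <=
    n`!%:R * (2 * (n%:R + 2)) ^+ n * (8 * n%:R) ^+ n ^+ 2.
Proof.
move=> n0 oO bO cO l0 C2u cvxu uneg detu [v Ov].
have [A [Au OA Olt2]] := large_simplex oO bO Ov.
have mO := open_rV_measurable oO.
have := MA_eigenvalue_ellipsoid n0 oO l0 C2u cvxu uneg detu
  (simplex_ellipsoid n0 cO Ov OA).
rewrite detZ exprMn => Hl.
have V0 : 0 <= volume O by exact/fine_ge0/measure_ge0.
have VA : volume O <= 4 ^+ n * `|\det A|.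
  rewrite -lee_fin /volume fineK; first exact: volume_large_simplex mO Au Olt2.
  by rewrite ge0_fin_numE ?measure_ge0// lebesgue_rV_bounded.
have {}VA : volume O ^+ 2 <= (4 ^+ n) ^+ 2 * \det A ^+ 2.
  by rewrite -[\det A ^+ 2]real_normK ?num_real// -exprMn lerXn2r// nnegrE// mulr_ge0.
apply: (le_trans (ler_wpM2l (ltW l0) VA)).
have -> : (8 * n%:R) ^+ n = 4 ^+ n / (2 * n%:R)^-1 ^+ n :> R.
  by rewrite exprVn invrK -exprMn; congr (_ ^+ n); ring.
move: Hl; set X := (2 * n%:R)^-1 ^+ n => Hl.
have X0 : 0 < X ^+ 2.
  by rewrite !exprn_gt0// invr_gt0 mulr_gt0// ltr0n.
rewrite expr_div_n [leRHS]mulrA ler_pdivlMr//.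
have -> : lambda * ((4 ^+ n) ^+ 2 * \det A ^+ 2) * X ^+ 2 =
    lambda * (X ^+ 2 * \det A ^+ 2) * (4 ^+ n) ^+ 2 by ring.
by rewrite ler_wpM2r// !exprn_ge0.
Qed.

Lemma inf_boundary_gradient_ge0 O u : (exists x, boundary O x) ->
  0 <= inf_boundary_gradient O u.
Proof.
move=> [x bx]; apply: lb_le_inf; first by exists (enorm (gradient_ext O u x)), x.
by move=> _ [y _ <-]; exact: enorm_ge0.
Qed.

Lemma inf_boundary_gradient_le O u x : boundary O x ->
  inf_boundary_gradient O u <= enorm (gradient_ext O u x).
Proof.
move=> bx; apply: ge_inf; last by exists x.
by exists 0 => _ [y _ <-]; exact: enorm_ge0.
Qed.

Lemma MA_gradient_bound O u (lambda : R) : (0 < n)%N -> open O -> bounded_set O ->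
  O !=set0 -> smooth_boundary O -> 0 < lambda -> Ck 2 O u -> C1_closure O u ->
  (forall x, O x -> u x < 0) -> MA_eigenproblem O lambda u ->
  volume (@unit_ball R n) * inf_boundary_gradient O u ^+ n <=
    lambda * Lpnorm n%:R O u ^+ n.
Proof.
move=> n0 oO bO O0 sO l0 C2u C1u uneg [detu ub].
have mO := open_rV_measurable oO.
have Ooo := lebesgue_rV_bounded mO bO.
have cu : {within closure O, continuous u} by case: C1u.
have [du /= d2u] := C2u.
pose m := inf_boundary_gradient O u; rewrite -/m.
have bne := boundary_nonempty n0 oO bO O0.
have m0 : 0 <= m := inf_boundary_gradient_ge0 u bne.
have [m_eq0|m_neq0] := eqVneq m 0.
  by rewrite m_eq0 expr0n eqn0Ngt n0 mulr0 mulr_ge0 ?exprn_ge0 ?Lpnorm_ge0// ltW.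
have {m_neq0}m0 : 0 < m by rewrite lt_neqAle eq_sym m_neq0.
have ucont x : O x -> {for x, continuous u}.
  by move=> Ox; exact/differentiable_continuous/du.
have gcont (k : R) x : O x -> {for x, continuous (fun x => k * `|u x| ^+ n)}.
  move=> Ox; apply: (@continuous_comp _ _ _ u (fun r : R => k * `|r| ^+ n)).
    exact: ucont.
  apply: cvgM; first exact: cvg_cst.
  apply: (@continuous_comp _ _ _ (fun r : R => `|r|) (fun r : R => r ^+ n)).
    exact: norm_continuous.
  exact: exprn_continuous.
have mu_n : measurable_fun O (fun x => (`|u x| ^+ n)%:E).
  apply/measurable_EFinP; apply: continuous_rV_measurable => // x Ox.
  rewrite (_ : (fun y : 'rV[R]_n => _) = fun y => 1 * `|u y| ^+ n); first exact: gcont.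
  by apply/funext => y; rewrite mul1r.
(* Finiteness is required for [fine] to return the integral; it holds because u is continuous on the
   compact closure. *)
have Ifin : (\int[lebesgue_rV n]_(x in O) (`|u x| ^+ n)%:E < +oo)%E.
  have [y0 Oy0] := O0.
  have cau : {within closure O, continuous (fun x => `|u x|)}.
    apply/subspace_continuousP => x cx; apply: cvg_norm.
    by have /subspace_continuousP/(_ _ cx) := cu.
  have [|z _ zmax] := EVT_max_rV _ (compact_closure bO) cau.
    by exists y0; exact: subset_closure.
  apply: (@le_lt_trans _ _ (\int[lebesgue_rV n]_(x in O) (cst (`|u z| ^+ n)%:E) x)%E).
    apply: ge0_le_integral => //.
    move=> x Ox; rewrite /cst lee_fin lerXn2r ?nnegrE//.
    by apply: zmax; rewrite inE; exact: subset_closure.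
  by rewrite integral_cst// lte_mul_pinfty// lee_fin exprn_ge0.
have key : (lebesgue_rV n [set p | (enorm p < m)%R] <=
    \int[lebesgue_rV n]_(x in O) (lambda * `|u x| ^+ n)%:E)%E.
  (* The negativity of u makes lambda |u|^n, hence the Jacobian of the gradient map, nonzero. *)
  apply: (measure_image_le (F := gradient u) (J := fun x => (hessian u x)^T)) => //.
  - move=> x Ox; split.
      rewrite unitmx_tr unitmxE detu// unitfE mulf_neq0 ?gt_eqF//.
      by rewrite exprn_gt0// normr_gt0 lt_eqF// uneg.
    by apply: gradient_jacobian => i; exact: (proj1 (d2u i)).
  - by move=> x; exact: gcont.
  - by move=> x Ox; rewrite det_tr detu// ger0_norm// mulr_ge0 ?exprn_ge0// ltW.
  - exact: measurable_ball_enorm.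
  - apply: gradient_image_ball => //.
    by move=> x; exact: inf_boundary_gradient_le.
rewrite lebesgue_rV_ball_enorm// in key.
rewrite -lee_fin (le_trans key)//.
under eq_integral do rewrite EFinM.
rewrite ge0_integralZl_EFin//; last exact: ltW.
rewrite Lpnorm_expn// EFinM fineK// ge0_fin_numE//; exact: integral_ge0.
Qed.

End eigenvalue_bounds.

Unset Implicit Arguments.

Theorem corollary3p2 (R : realType) (n : nat) (n_gt0 : (0 < n)%N) :
  exists C : R,
  forall (Omega : set 'rV[R]_n) (lambda : R) (u : 'rV[R]_n -> R),
    smooth_uniformly_convex_domain Omega ->
    MA_eigenvalue Omega lambda ->
    Ck 2 Omega u -> C1_closure Omega u ->
    nonzero_convex Omega u ->
    MA_eigenproblem Omega lambda u ->
    volume (@unit_ball R n) *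
      (inf_boundary_gradient Omega u / Lpnorm n%:R Omega u) ^+ n <= lambda
    /\
    inf_boundary_gradient Omega u
      <= C / (volume Omega `^ (2 / n%:R)) * Lpnorm n%:R Omega u.
Proof.
pose b := volume (@unit_ball R n).
have b0 : 0 < b := volume_unit_ball_gt0.
pose K : R := n`!%:R * (2 * (n%:R + 2)) ^+ n * (8 * n%:R) ^+ n ^+ 2.
have K0 : 0 <= K by rewrite !mulr_ge0 ?exprn_ge0 ?mulr_ge0 ?addr_ge0.
have nR0 : n%:R != 0 :> R by rewrite pnatr_eq0 -lt0n.
(* From b m^n <= lambda N^n and lambda V^2 <= K follows m^n <= (K / b) N^n / V^2, and the n-th root
   is taken. *)
exists ((K / b) `^ n%:R^-1) => O lambda u [oO O0 bO sO [cO _]] [l0 _] C2u C1u nzu MAu.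
have cu : {within closure O, continuous u} by case: C1u.
have uneg := convex_lt0 n_gt0 oO bO cu (proj2 MAu) nzu.
have H1 := MA_gradient_bound n_gt0 oO bO O0 sO l0 C2u C1u uneg MAu.
have H2 := MA_volume_bound n_gt0 oO bO cO l0 C2u (proj2 nzu) uneg (proj1 MAu) O0.
have m0 := inf_boundary_gradient_ge0 u (boundary_nonempty n_gt0 oO bO O0).
have N0 := @Lpnorm_ge0 R n n%:R O u.
have V0 : 0 < volume O.
  apply: fine_gt0; rewrite lebesgue_rV_open_gt0//=.
  exact: (lebesgue_rV_bounded (open_rV_measurable oO) bO).
move: (inf_boundary_gradient O u) (Lpnorm n%:R O u) (volume O) H1 H2 m0 N0 V0.
move=> m N V H1 H2 m0 N0 V0; rewrite -/b -/K in H1 H2 *.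
split.
  (* If N = 0, the quotient m / N is 0 by convention and the bound reduces to lambda >= 0. *)
  move: N0; rewrite le_eqVlt => /predU1P[<-|N0].
    by rewrite invr0 mulr0 expr0n eqn0Ngt n_gt0 mulr0 ltW.
  by rewrite expr_div_n mulrA ler_pdivrMr ?exprn_gt0.
have root (a : R) : 0 <= a -> (a `^ n%:R^-1) ^+ n = a.
  by move=> a0; rewrite -powR_mulrn ?powR_ge0// -powRrM mulVf// powRr1.
rewrite -(@ler_pXn2r _ n)// ?nnegrE//; last first.
  by apply: mulr_ge0 => //; apply: divr_ge0; exact: powR_ge0.
rewrite exprMn expr_div_n root ?divr_ge0 ?(ltW b0)//.
have -> : (V `^ (2 / n%:R)) ^+ n = V ^+ 2.
  by rewrite powRrM root ?powR_ge0// powR_mulrn// ltW.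
rewrite -(ler_pM2l b0) (le_trans H1)//.
have -> : b * (K / b / V ^+ 2 * N ^+ n) = K / V ^+ 2 * N ^+ n.
  by field; rewrite !gt_eqF.
by rewrite ler_wpM2r ?exprn_ge0// ler_pdivlMr ?exprn_gt0.
Qed.
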